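(* Let $\Gamma$ be a finite simple graph, and let $P$ be a locally finite poset equipped with a surjective coloring function $\kappa:P\to\Gamma$. Let $\mathcal{FI}(P)$ be the lattice of filter-ideal splits of $P$. Let $\mathfrak{g}'$ be the derived Kac--Moody algebra with simply laced Dynkin diagram $\Gamma$, and let $\mathfrak{b}'_+$ be its positive Borel derived subalgebra. (a) The lattice $\mathcal{FI}(P)$ carries an upper $P$-minuscule representation of $\mathfrak{b}'_+$ if and only if $P$ is a $\Gamma$-colored $d$-complete poset. (b) The lattice $\mathcal{FI}(P)$ carries a $P$-minuscule representation of $\mathfrak{g}'$ if and only if $P$ is a $\Gamma$-colored minuscule poset.
   Context: Graph and poset. $\Gamma$ has no loops or multiple edges; its vertex set is also denoted $\Gamma$ and its vertices are called colors. For $a,b\in\Gamma$, $a\sim b$ means $\{a,b\}$ is an edge ($a,b$ are adjacent); $a,b$ are distant if $a\ne b$ and $\{a,b\}$ is not an edge. Put $\theta_{ab}=2$ if $a=b$, $\theta_{ab}=-1$ if $a\sim b$, $\theta_{ab}=0$ if $a,b$ are distant. Locally finite means every closed interval of $P$ is finite. $P_a:=\kappa^{-1}(a)$. $x\to y$ means $x$ is covered by $y$; $x,y$ are neighbors if $x\to y$ or $y\to x$. A filter is an upwardly closed subset, an ideal a downwardly closed subset. A split is a pair $(F,I)$ with $F$ a filter and $I=P-F$; $\mathcal{FI}(P)$ is the set of all splits, ordered by inclusion of ideals. Write $(F-x,I+x)$ for $(F\setminus\{x\},I\cup\{x\})$ and $(F+y,I-y)$ for $(F\cup\{y\},I\setminus\{y\})$.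 Operators. $V=\langle\mathcal{FI}(P)\rangle$ is the free complex vector space with basis $\{\langle F,I\rangle\}_{(F,I)\in\mathcal{FI}(P)}$. For $a\in\Gamma$ define linearly $X_a.\langle F,I\rangle=\sum\langle F-x,I+x\rangle$, summed over the elements $x$ of color $a$ minimal in $F$, and $Y_a.\langle F,I\rangle=\sum\langle F+y,I-y\rangle$, summed over the elements $y$ of color $a$ maximal in $I$. Any assertion about these operators is understood to include that the defining sums are finite, so that the operators are well defined. (Finiteness is automatic when EC below holds.) The $X_a$ are collectively $X$-square nilpotent if $X_a^2=0$ for all $a$. Lie algebras. Consider generators $x_a,y_a,h_a$ ($a\in\Gamma$) and relations: XX: $[x_b,x_a]=0$ for $a,b$ distant, and $[x_a,[x_a,x_b]]=0$ for all $a,b$; YY: the same with $y$ in place of $x$; HH: $[h_b,h_a]=0$; HX: $[h_b,x_a]=\theta_{ab}x_a$; HY: $[h_b,y_a]=-\theta_{ab}y_a$; XY: $[x_a,y_a]=h_a$, and $[x_b,y_a]=0$ for $a\ne b$. $\mathfrak{b}'_+$ is generated by $\{x_a,h_a\}$ subject to XX, HH, HX. $\mathfrak{g}'$ is generated by $\{x_a,y_a,h_a\}$ subject to all the relations. Representations. $\mathcal{FI}(P)$ carries a representation of one of these algebras if there are operators on $V$ for its generators, with $X_a$ for $x_a$, $Y_a$ for $y_a$, and operators $H_a$ for $h_a$ that are diagonal in the basis $\{\langle F,I\rangle\}$, satisfying the defining relations of the algebra with respect to the commutator on $\mathrm{End}(V)$. The eigenvalue set of $\{H_a\}$ is the set of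 all eigenvalues of $H_a$ on basis vectors $\langle F,I\rangle$, over all $a\in\Gamma$ and all splits. A representation of $\mathfrak{b}'_+$ carried by $\mathcal{FI}(P)$ is upper $P$-minuscule if it is $X$-square nilpotent, the eigenvalue set of $\{H_a\}$ is contained in $\{-1,0,1,2,\dots\}$, and for every split $(F,I)$ and $a\in\Gamma$ one has $H_a.\langle F,I\rangle=-\langle F,I\rangle$ if and only if $F$ has a minimal element of color $a$. A representation of $\mathfrak{g}'$ carried by $\mathcal{FI}(P)$ is $P$-minuscule if the eigenvalue set of $\{H_a\}$ is contained in $\{-1,0,1\}$. Coloring properties. EC: elements with equal colors are comparable. NA: neighbors have adjacent colors. AC: elements with adjacent colors are comparable. I2A: for every $a\in\Gamma$, the open interval between any two consecutive elements of color $a$ (i.e. $x<y$ in $P_a$ with no element of $P_a$ strictly between) contains exactly two elements whose colors are adjacent to $a$. Mx1GA: for every $a\in\Gamma$, if $x$ is maximal in $P_a$, then at most one element greater than $x$ has color adjacent to $a$. Mn1LA: for every $a\in\Gamma$, if $x$ is minimal in $P_a$, then at most one element less than $x$ has color adjacent to $a$. $P$ is $\Gamma$-colored $d$-complete if it satisfies EC, NA, AC, I2A, and Mx1GA. It is $\Gamma$-colored minuscule if it additionally satisfies Mn1LA. *)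

(* Defs.v *)
From HB Require Import structures.
From mathcomp Require Import all_boot all_order all_algebra.
From mathcomp Require Import all_classical reals.
From mathcomp Require Import complex freeg.

Set Implicit Arguments.
Unset Strict Implicit.
Unset Printing Implicit Defensive.

Import Order.TTheory GRing.Theory Num.Theory.

Local Open Scope classical_set_scope.

Section Posets.
Context {d : Order.disp_t} {P : porderType d}.
Implicit Types (x y z : P) (A F I : set P).

Local Open Scope order_scope.
Local Open Scope classical_set_scope.

Definition locally_finite : Prop := forall x y, finite_set [set z | x <= z <= y].

Definition minimal_in A x : Prop := A x /\ forall y, A y -> ~~ (y < x).
Definition maximal_in A x : Prop := A x /\ forall y, A y -> ~~ (x < y).

Definition covers x y : Prop := x < y /\ forall z, ~~ (x < z < y).
Definition neighbors x y : Prop := covers x y \/ covers y x.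

Definition upward_closed F : Prop := forall x y, x <= y -> F x -> F y.

Definition is_split (FI : set P * set P) : bool :=
  `[< upward_closed FI.1 /\ FI.2 = ~` FI.1 >].

End Posets.

Arguments locally_finite {d} P.

Record fi_split {d : Order.disp_t} (P : porderType d) := FISplit {
  fi_pair :> set P * set P ;
  fi_pairP : is_split fi_pair }.

HB.instance Definition _ d (P : porderType d) :=
  [isSub for @fi_pair d P].
HB.instance Definition _ d (P : porderType d) :=
  [Choice of fi_split P by <:].

Section Splits.
Context {d : Order.disp_t} {P : porderType d}.
Implicit Types (s : fi_split P) (x y : P).

Definition filter_of s : set P := s.1.
Definition ideal_of s : set P := s.2.

(* The default value [s] of [insubd] is used only when the pair is not a split,
   which does not happen for [x] minimal in the filter, resp. [y] maximal in
   the ideal: see [val_filter_to_ideal] and [val_ideal_to_filter]. *)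
Definition filter_to_ideal s x : fi_split P :=
  insubd s (filter_of s `\ x, ideal_of s `|` [set x]).
Definition ideal_to_filter s y : fi_split P :=
  insubd s (filter_of s `|` [set y], ideal_of s `\ y).

Lemma val_filter_to_ideal s x : minimal_in (filter_of s) x ->
  val (filter_to_ideal s x) = (filter_of s `\ x, ideal_of s `|` [set x]).
Proof.
move=> [Fx minx]; rewrite insubdK//; apply/asboolP => /=.
have /asboolP[upF IE] := fi_pairP s.
split=> [y z yz [Fy yx]|].
  split=> [|/= zx]; first exact: upF yz Fy.
  move: (minx y Fy); rewrite lt_neqAle -zx yz andbT negbK => /eqP yz'.
  by apply: yx; rewrite /= yz' zx.
by rewrite /ideal_of /filter_of IE setCD.
Qed.

Lemma val_ideal_to_filter s y : maximal_in (ideal_of s) y ->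
  val (ideal_to_filter s y) = (filter_of s `|` [set y], ideal_of s `\ y).
Proof.
move=> [Iy maxy]; rewrite insubdK//; apply/asboolP => /=.
have /asboolP[upF IE] := fi_pairP s.
split=> [x z xz [Fx|/= xy]|].
- by left; exact: upF xz Fx.
- have [->|zy] := eqVneq z y; first by right.
  left; apply: contrapT => Fz.
  suff Iz : ideal_of s z by move: (maxy z Iz); rewrite lt_neqAle -xy xz xy eq_sym zy.
  by rewrite /ideal_of IE.
- by rewrite /ideal_of /filter_of IE setCU -setDE.
Qed.

End Splits.

Section Coloring.
Context (G : finType) (adj : rel G) {d : Order.disp_t} {P : porderType d}.
Variable kappa : P -> G.
Implicit Types (a b : G) (x y z : P).

Local Open Scope order_scope.
Local Open Scope classical_set_scope.

Definition color_class a : set P := [set x | kappa x = a].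

Definition EC : Prop := forall x y, kappa x = kappa y -> x >=< y.
Definition NA : Prop := forall x y, neighbors x y -> adj (kappa x) (kappa y).
Definition AC : Prop := forall x y, adj (kappa x) (kappa y) -> x >=< y.

Definition consecutive a x y : Prop :=
  [/\ color_class a x, color_class a y, x < y &
      forall z, color_class a z -> ~~ (x < z < y)].

Definition I2A : Prop := forall a x y, consecutive a x y ->
  ([set z | x < z < y /\ adj a (kappa z)] #= `I_2)%card.
Definition Mx1GA : Prop := forall a x, maximal_in (color_class a) x ->
  is_subset1 [set y | x < y /\ adj a (kappa y)].
Definition Mn1LA : Prop := forall a x, minimal_in (color_class a) x ->
  is_subset1 [set y | y < x /\ adj a (kappa y)].

Definition colored_d_complete : Prop := [/\ EC, NA, AC, I2A & Mx1GA].
Definition colored_minuscule : Prop := colored_d_complete /\ Mn1LA.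

End Coloring.

Local Open Scope ring_scope.

Section Relations.
Context (G : finType) (adj : rel G).
Implicit Types a b : G.

Definition distant a b : bool := (a != b) && ~~ adj a b.

Definition theta a b : int := if a == b then 2 else if adj a b then -1 else 0.

Context (K : fieldType) (L : lmodType K) (br : L -> L -> L).
Implicit Types x y h : G -> L.

(* XX when applied to the x_a, YY when applied to the y_a *)
Definition serre_relations x : Prop :=
  (forall a b, distant a b -> br (x b) (x a) = 0) /\
  (forall a b, br (x a) (br (x a) (x b)) = 0).
Definition HH h : Prop := forall a b, br (h b) (h a) = 0.
Definition HX h x : Prop :=
  forall a b, br (h b) (x a) = (theta a b)%:~R *: x a.
Definition HY h y : Prop :=
  forall a b, br (h b) (y a) = - (theta a b)%:~R *: y a.
Definition XY x y h : Prop :=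
  (forall a, br (x a) (y a) = h a) /\
  (forall a b, a != b -> br (x b) (y a) = 0).

Definition borel_relations x h : Prop :=
  [/\ serre_relations x, HH h & HX h x].
Definition kac_moody_relations x y h : Prop :=
  [/\ serre_relations x, serre_relations y, HH h, HX h x & HY h y /\ XY x y h].

End Relations.

Section LinearExtension.
Context (K : fieldType) (B : choiceType) (M : lmodType K) (f : B -> M).

Definition lin_ext (v : {freeg B / K}) : M := fglift f v.

Lemma lin_ext_is_linear : linear lin_ext.
Proof.
have addf := lift_is_additive f.
pose g := HB.pack_for {additive {freeg B / K} -> M} (fglift f)
  (GRing.isZmodMorphism.Build _ _ (fglift f) addf).
have gE v : fglift f v = g v by [].
rewrite /lin_ext => k u v; rewrite !gE raddfD; congr (_ + _).
rewrite -[in RHS](freeg_sumE u) [k *: u]/(fgscale k u) /fgscale.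
rewrite !(raddf_sum g) scaler_sumr.
by apply: eq_bigr => x _; rewrite -!gE !liftU scalerA.
Qed.

HB.instance Definition _ :=
  GRing.isLinear.Build K {freeg B / K} M *:%R lin_ext lin_ext_is_linear.

Lemma lin_ext_basis (b : B) : lin_ext << b >> = f b.
Proof. by rewrite /lin_ext liftU scale1r. Qed.

End LinearExtension.

Section Representations.
Context (R : realType) (G : finType) (adj : rel G).
Context {d : Order.disp_t} {P : porderType d} (kappa : P -> G).
Implicit Types (s : fi_split P) (a : G).

Local Notation C := R[i].
Local Notation V := {freeg (fi_split P) / C}.
Local Notation ket s := (<< s >> : V).

Definition minimals a s : set P :=
  [set x | minimal_in (filter_of s) x /\ kappa x = a].
Definition maximals a s : set P :=
  [set y | maximal_in (ideal_of s) y /\ kappa y = a].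

(* [\sum_(x \in A) F x] is 0 by convention when the support is infinite, so
   the two operators are meaningful under [X_finite] and [Y_finite] only. *)
Definition X_op a : {linear V -> V} :=
  lin_ext (fun s => \sum_(x \in minimals a s) ket (filter_to_ideal s x)).
Definition Y_op a : {linear V -> V} :=
  lin_ext (fun s => \sum_(y \in maximals a s) ket (ideal_to_filter s y)).

Definition X_finite : Prop := forall a s, finite_set (minimals a s).
Definition Y_finite : Prop := forall a s, finite_set (maximals a s).

Definition commutator (f g : V -> V) : V -> V := (f \o g) - (g \o f).

Implicit Type H : G -> {linear V -> V}.

Definition diagonal H : Prop :=
  forall a s, exists c : C, H a (ket s) = c *: ket s.

Definition eigenvalue_set H : set C :=
  [set c | exists a s, H a (ket s) = c *: ket s].

Definition borel_representation H : Prop :=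
  [/\ X_finite, diagonal H & borel_relations adj commutator X_op H].

Definition kac_moody_representation H : Prop :=
  [/\ X_finite, Y_finite, diagonal H &
      kac_moody_relations adj commutator X_op Y_op H].

Definition X_square_nilpotent : Prop := forall a (v : V), X_op a (X_op a v) = 0.

Definition upper_P_minuscule H : Prop :=
  [/\ borel_representation H,
      X_square_nilpotent,
      eigenvalue_set H `<=` [set c | c = -1 \/ exists n : nat, c = n%:R] &
      forall s a, H a (ket s) = - ket s <-> minimals a s !=set0].

Definition P_minuscule H : Prop :=
  kac_moody_representation H /\
  eigenvalue_set H `<=` [set c | [\/ c = -1, c = 0 | c = 1]].

Definition carries_upper_P_minuscule : Prop := exists H, upper_P_minuscule H.
Definition carries_P_minuscule : Prop := exists H, P_minuscule H.

End Representations.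

(* Main.v *)
Require Import Defs.
From mathcomp Require Import all_boot all_order all_algebra.
From mathcomp Require Import all_classical reals.
From mathcomp Require Import complex freeg finmap zify.

Set Implicit Arguments.
Unset Strict Implicit.
Unset Printing Implicit Defensive.

Import Order.TTheory GRing.Theory Num.Theory.

Local Open Scope classical_set_scope.

(** Everything is read off one combinatorial relation. Write [step a s t] when
the split [t] arises from [s] by moving one element of color [a] from the filter
to the ideal. The operator [X_a] sends [s] to the sum of its [a]-successors and
[Y_a] sends [s] to the sum of its [a]-predecessors, and a diagonal operator
[H_a] is the same thing as a weight [h a s]. The defining relations become
statements about steps and weights: [HX] says that a step of color [a] adds
[theta a b] to the weight of color [b] ([weight_shift]); the minuscule
conditions bound the weight and say that it is [-1] exactly when a step of that
color leaves [s] ([minimal_weight]).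

From representation to coloring. No two consecutive steps may have the same
color, by [X_a^2 = 0] or by the weight bounds; applied to the filter generated
by two incomparable elements of equal color this gives EC. The other properties
come from following the weight along a path of moves which starts at a
principal filter: after removing a finite set [D] from the filter, the weight
has changed by [2] for every element of [D] of color [a] and by [-1] for every
element of color adjacent to [a] ([weight_path]). For consecutive elements [x]
and [y] of color [a], removing the half-open interval from [x] to [y] must take
the weight from [-1] to [-1], so there are exactly two elements of adjacent color
between them. If [x] is maximal in its color and two elements of adjacent color
lie above it, removing everything from [x] up to these two gives weight at most
[-1], hence another element of color [a] above [x], which is absurd. The property Mn1LA is obtained dually with the value [1].
In the case of the full algebra, the relation [XY] shows that weight [-1]
requires a step out of [s] and that weight [1] requires a step into [s], because
[X_a] and [Y_a] have nonnegative coefficients.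

From coloring to representation. Under EC the successor and the predecessor of a
given color are unique, so [X_a] and [Y_a] are mutually inverse partial
injections on the splits, and a relation between words in these operators can be
checked on paths of steps. What is left is to write down a weight. If the filter
has a least element [v] of color [a], the weight of color [a] is the number of
elements of the filter below [v] with color adjacent to [a], minus [1]; if it has
none but the ideal has a greatest element [u] of color [a], the weight is [1]
minus the number of elements of the ideal above [u] with color adjacent to [a];
otherwise it is [0]. In a d-complete poset infinitely many elements may lie below [v]; the
count used ([reg_count]) therefore replaces the number of elements of any color
occurring infinitely often by [1]. This is harmless because an element moved by
a step always belongs to a color with only finitely many elements there. *)

(** * Finite subsets and covers *)

Section FiniteSets.

(** Stated for a relation rather than an order so that it yields both
minimal and maximal elements. *)
Lemma seq_minimal (T : eqType) (r : rel T) (s : seq T) (x : T) :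
  irreflexive r -> transitive r -> x \in s ->
  exists2 m, m \in s & (m == x) || r m x /\ forall y, y \in s -> ~~ r y m.
Proof.
move=> rI rT xs.
have [n] := ubnP (count (r^~ x) s); elim: n => // n IHn in x xs *.
have [/hasP[y ys ryx]|/hasPn nor] := boolP (has (r^~ x) s); last first.
  by exists x => //; rewrite eqxx; split.
rewrite ltnS => le_n.
have lt_c : (count (r^~ y) s < count (r^~ x) s)%N.
  have sub : subpred (r^~ y) (r^~ x) by move=> z rzy /=; exact: rT rzy ryx.
  elim: s ys {xs IHn le_n} => //= z s IHs; rewrite inE => /orP[/eqP <-|ys].
    by rewrite rI ryx /= add0n add1n ltnS sub_count.
  rewrite -addnS leq_add ?IHs//.
  by case: (boolP (r z y)) => // /sub /= ->.
have [m ms [mx minm]] := IHn y ys (leq_trans lt_c le_n).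
exists m => //; split=> //; apply/orP; right.
by case/orP: mx => [/eqP ->//|rmy]; exact: rT rmy ryx.
Qed.

Context {d : Order.disp_t} {P : porderType d}.
Implicit Types (A : set P) (x y : P).
Local Open Scope order_scope.
Local Open Scope classical_set_scope.

Lemma finite_minimal A x : finite_set A -> A x ->
  exists2 m, m <= x & minimal_in A m.
Proof.
move=> /finite_seqP[s ->] xs.
have [m ms [mx minm]] := seq_minimal (@ltxx _ P) (@lt_trans _ P) xs.
by exists m; [rewrite le_eqVlt | split].
Qed.

Lemma finite_maximal A x : finite_set A -> A x ->
  exists2 m, x <= m & maximal_in A m.
Proof.
move=> /finite_seqP[s ->] xs.
have gtT : transitive (fun y z : P => z < y).
  by move=> y z w zy yw; exact: lt_trans yw zy.
have [m ms [mx minm]] := seq_minimal (@ltxx _ P : irreflexive (fun y z => z < y)) gtT xs.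
by exists m; [rewrite le_eqVlt eq_sym | split].
Qed.

Lemma finite_uniq_seq (A : set P) : finite_set A -> exists2 D : seq P, uniq D & A = [set` D].
Proof.
move=> /finite_seqP[D ->]; exists (undup D); first exact: undup_uniq.
by apply/seteqP; split=> z /=; rewrite mem_undup.
Qed.

Lemma comparable_minimal_eq A x y : x >=< y ->
  minimal_in A x -> minimal_in A y -> x = y.
Proof.
rewrite /Order.comparable !le_eqVlt => xy [Ax minx] [Ay miny]; move: xy.
by rewrite (negPf (miny _ Ax)) (negPf (minx _ Ay)) !orbF => /orP[]/eqP.
Qed.

Lemma comparable_maximal_eq A x y : x >=< y ->
  maximal_in A x -> maximal_in A y -> x = y.
Proof.
rewrite /Order.comparable !le_eqVlt => xy [Ax maxx] [Ay maxy]; move: xy.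
by rewrite (negPf (maxx _ Ay)) (negPf (maxy _ Ax)) !orbF => /orP[]/eqP.
Qed.

Hypothesis P_lf : locally_finite P.

Lemma cover_above x y : x < y -> exists2 z, z <= y & covers x z.
Proof.
move=> xy.
have fin : finite_set [set z | x < z <= y].
  by apply: sub_finite_set (P_lf x y) => z /= /andP[/ltW -> ->].
have [|z zy [/andP[xz _] minz]] := @finite_minimal _ y fin; first by rewrite /= xy /=.
exists z => //; split=> // w; apply/negP => /andP[xw wz].
by move: (minz w); rewrite wz /= xw /= (le_trans (ltW wz) zy) => /(_ isT).
Qed.

Lemma cover_below x y : x < y -> exists2 z, x <= z & covers z y.
Proof.
move=> xy.
have fin : finite_set [set z | x <= z < y].
  by apply: sub_finite_set (P_lf x y) => z /= /andP[-> /ltW ->].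
have [|z xz [/andP[_ zy] maxz]] := @finite_maximal _ x fin; first by rewrite /= lexx.
exists z => //; split=> // w; apply/negP => /andP[zw wy].
by move: (maxz w); rewrite zw /= wy andbT (le_trans xz (ltW zw)) => /(_ isT).
Qed.

End FiniteSets.

(** * Moving one element between filter and ideal *)

Section Moves.
Context {d : Order.disp_t} {P : porderType d}.
Implicit Types (s t u r : fi_split P) (x y z : P) (F : set P).
Local Open Scope order_scope.
Local Open Scope classical_set_scope.

Lemma split_upward s : upward_closed (filter_of s).
Proof. by have /asboolP[] := fi_pairP s. Qed.

Lemma split_idealE s : ideal_of s = ~` filter_of s.
Proof. by have /asboolP[] := fi_pairP s. Qed.

Lemma split_idealP s x : ideal_of s x <-> ~ filter_of s x.
Proof. by rewrite split_idealE. Qed.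

Lemma split_ext s t : filter_of s = filter_of t -> s = t.
Proof.
move=> eF; apply: val_inj; rewrite [val s]surjective_pairing [val t]surjective_pairing.
congr (_, _); first exact: eF.
by rewrite -[_.2]/(ideal_of s) -[_.2]/(ideal_of t) !split_idealE eF.
Qed.

Lemma split_exists F : upward_closed F -> exists s, filter_of s = F.
Proof.
move=> upF.
have spF : is_split (F, ~` F) by apply/asboolP.
by exists (FISplit spF).
Qed.

(** The equation on filters determines the ideals too, so this single
relation describes a move in both directions: [x] is then automatically minimal
in the filter of [s] and maximal in the ideal of [t]. *)
Definition move x s t := filter_of s x /\ filter_of t = filter_of s `\ x.

(** An element of the filter below [x] would survive the move, and would
drag [x] back into the filter of [t], which is upward closed. *)
Lemma move_minimal x s t : move x s t -> minimal_in (filter_of s) x.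
Proof.
move=> [sx tE]; split=> // y sy; apply/negP => yx.
have ty : filter_of t y by rewrite tE; split=> //= yx'; rewrite yx' ltxx in yx.
by have := split_upward (ltW yx) ty; rewrite tE => -[_]; apply.
Qed.

Lemma move_maximal x s t : move x s t -> maximal_in (ideal_of t) x.
Proof.
move=> [sx tE]; split=> [|y]; first by apply/split_idealP; rewrite tE => -[_]; apply.
move=> /split_idealP ty; apply/negP => xy; apply: ty; rewrite tE.
by split; [exact: split_upward (ltW xy) sx | move=> /= yx; rewrite yx ltxx in xy].
Qed.

Lemma minimal_move x s : minimal_in (filter_of s) x -> move x s (filter_to_ideal s x).
Proof.
by move=> minx; split; [case: minx | rewrite {1}/filter_of val_filter_to_ideal].
Qed.

Lemma maximal_move x s : maximal_in (ideal_of s) x -> move x (ideal_to_filter s x) s.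
Proof.
move=> maxx; have [/split_idealP Ix _] := maxx.
have E : filter_of (ideal_to_filter s x) = filter_of s `|` [set x].
  by rewrite {1}/filter_of val_ideal_to_filter.
split; rewrite E; first by right.
rewrite setDUl setDv setU0 setDidl //; apply/disjoints_subset.
by move=> y sy /= yx; rewrite yx in sy.
Qed.

Lemma move_inj_r x s t t' : move x s t -> move x s t' -> t = t'.
Proof. by move=> [_ tE] [_ t'E]; apply: split_ext; rewrite tE. Qed.

Lemma move_filter_source x s t : move x s t -> filter_of s = filter_of t `|` [set x].
Proof.
move=> [sx ->]; apply/seteqP; split=> [y sy|y [[]//|->//]].
by have [->|/eqP yx] := eqVneq y x; [right | left; split].
Qed.

Lemma move_inj_l x s s' t : move x s t -> move x s' t -> s = s'.
Proof.
by move=> /move_filter_source sE /move_filter_source s'E; apply: split_ext; rewrite sE.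
Qed.

(** Two distinct minimal elements of a filter can be removed in either
order. *)
Lemma move_diamond_down x y s t t' : x <> y -> move x s t -> move y s t' ->
  exists2 u, move y t u & move x t' u.
Proof.
move=> xy mx my; have [sx tE] := mx; have [sy t'E] := my.
have miny : minimal_in (filter_of t) y.
  split=> [|z]; first by rewrite tE; split=> // /esym.
  by rewrite tE => -[sz _]; case: (move_minimal my) => _; apply.
have [ty uE] := minimal_move miny.
exists (filter_to_ideal t y) => //; split; first by rewrite t'E.
by rewrite uE tE t'E !setDDl setUC.
Qed.

(** Two distinct maximal elements of an ideal can be removed in either
order. *)
Lemma move_diamond_up x y t t' u : x <> y -> move x t u -> move y t' u ->
  exists2 s, move y s t & move x s t'.
Proof.
move=> xy mx my; have [tx uE] := mx; have [t'y u'E] := my.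
have tF := move_filter_source mx; have t'F := move_filter_source my.
have [_ maxx] := move_maximal mx; have [Iy maxy] := move_maximal my.
have My : maximal_in (ideal_of t) y.
  split=> [|z /split_idealP tz].
    apply/split_idealP; rewrite tF => -[|/esym//].
    by move/split_idealP: Iy.
  by apply: maxy; apply/split_idealP => uz; apply: tz; rewrite tF; left.
have m := maximal_move My; exists (ideal_to_filter t y) => //.
have sF := move_filter_source m.
split; first by rewrite sF; left.
rewrite sF tF t'F setUAC setDUl setDv setU0 setDidl//.
apply/disjoints_subset => z [uz|->] /= zx; last exact: xy.
by move: uz; rewrite uE => -[_]; apply.
Qed.

(** The only element that can prevent [y] from being minimal before the
move of [x] is [x] itself, and then [y] covers [x]. *)
Lemma move_move_down x y s t u : move x s t -> move y t u -> ~ covers x y ->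
  exists t', move y s t'.
Proof.
move=> mx my ncov; exists (filter_to_ideal s y); apply: minimal_move.
have [ty miny] := move_minimal my; have [sx tE] := mx.
have sy : filter_of s y by move: ty; rewrite tE => -[].
split=> // z sz; apply/negP => zy.
have zx : z = x.
  by apply: contrapT => zx; move: (miny z); rewrite zy tE => /(_ (conj sz zx)).
apply: ncov; split; rewrite -?zx // => w; apply/negP => /andP[zw wy].
move: (miny w); rewrite wy tE => H.
suff : (filter_of s `\ x) w by move/H.
by split; [exact: split_upward (ltW zw) sz | rewrite -zx => /= wz; rewrite wz ltxx in zw].
Qed.

Lemma split_above (A : set P) : exists s, filter_of s = [set z | exists2 y, A y & y <= z].
Proof. by apply: split_exists => x y xy [w Aw wx]; exists w => //; exact: le_trans xy. Qed.

End Moves.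

(** * Colored steps *)

Section Steps.
Context (G : finType) {d : Order.disp_t} {P : porderType d} (kappa : P -> G).
Implicit Types (a b : G) (s t u r : fi_split P) (x y z : P).
Local Open Scope order_scope.
Local Open Scope classical_set_scope.

Definition step a s t := exists2 x, kappa x = a & move x s t.

Lemma minimal_step x s : minimal_in (filter_of s) x ->
  step (kappa x) s (filter_to_ideal s x).
Proof. by exists x => //; exact: minimal_move. Qed.

Lemma maximal_step x s : maximal_in (ideal_of s) x ->
  step (kappa x) (ideal_to_filter s x) s.
Proof. by exists x => //; exact: maximal_move. Qed.

Definition no_repeated_step := forall a s t u, step a s t -> step a t u -> False.

Lemma step_inj_r a s t t' : EC kappa -> step a s t -> step a s t' -> t = t'.
Proof.
move=> ec [x xa mx] [y ya my].
have E : x = y.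
  by apply: comparable_minimal_eq (move_minimal mx) (move_minimal my); apply: ec; rewrite xa.
by rewrite E in mx; exact: move_inj_r mx my.
Qed.

Lemma step_diamond_down a b s t t' : a != b -> step a s t -> step b s t' ->
  exists2 u, step b t u & step a t' u.
Proof.
move=> ab [x xa mx] [y yb my].
have xy : x <> y by move=> E; rewrite -xa -yb E eqxx in ab.
by have [u m1 m2] := move_diamond_down xy mx my; exists u; [exists y | exists x].
Qed.

Lemma step_diamond_up a b t t' u : a != b -> step a t u -> step b t' u ->
  exists2 s, step b s t & step a s t'.
Proof.
move=> ab [x xa mx] [y yb my].
have xy : x <> y by move=> E; rewrite -xa -yb E eqxx in ab.
by have [s m1 m2] := move_diamond_up xy mx my; exists s; [exists y | exists x].
Qed.

End Steps.

(** * Coloring properties forced by steps and weights *)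

Section Necessity.
Context (G : finType) (adj : rel G).
Hypotheses (adj_sym : symmetric adj) (adj_irr : irreflexive adj).
Context {d : Order.disp_t} {P : porderType d}.
Hypothesis P_lf : locally_finite P.
Context (kappa : P -> G).
Implicit Types (a b : G) (s t u r : fi_split P) (x y z : P).
Local Open Scope order_scope.
Local Open Scope classical_set_scope.

Notation step := (step kappa).

(** The part of the commutation of [X_a] and [X_b] that can be read off
before the successors of a split are known to be unique. *)
Definition distant_steps_swap := forall a b s t u, distant adj a b ->
  step a s t -> step b t u -> exists t', step b s t'.

Lemma incomparable_minimal x y : ~ x >=< y ->
  exists s, minimal_in (filter_of s) x /\ minimal_in (filter_of s) y.
Proof.
move=> /negP; rewrite negb_or => /andP[nxy nyx].
have [s sE] := split_above [set x; y]; exists s; rewrite sE.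
split; (split=> [|z [w [->|->] wz]]).
- by exists x => //; left.
- by apply/negP => /(le_lt_trans wz); rewrite ltxx.
- by apply/negP => /(le_lt_trans wz)/ltW; exact/negP.
- by exists y => //; right.
- by apply/negP => /(le_lt_trans wz)/ltW; exact/negP.
- by apply/negP => /(le_lt_trans wz); rewrite ltxx.
Qed.

(** If [x] and [y] were incomparable of the same color, both could be
removed successively from the filter they generate. *)
Lemma no_repeated_step_EC : no_repeated_step kappa -> EC kappa.
Proof.
move=> norep x y xy; apply: contrapT => ncmp.
have [s [minx miny]] := incomparable_minimal ncmp.
have xNy : x <> y by move=> E; apply: ncmp; rewrite E /Order.comparable lexx.
have [u m _] := move_diamond_down xNy (minimal_move minx) (minimal_move miny).
apply: (norep (kappa x) s (filter_to_ideal s x) u).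
  by exists x => //; exact: minimal_move.
by exists y.
Qed.

Lemma principal_minimal s x : filter_of s = [set z | x <= z] ->
  minimal_in (filter_of s) x /\ forall y, minimal_in (filter_of s) y -> y = x.
Proof.
move=> sE; split.
  rewrite sE; split=> [|y /= xy]; first exact: lexx.
  by apply/negP => /(le_lt_trans xy); rewrite ltxx.
move=> y; rewrite sE => -[/= xy /(_ x)]; rewrite /= lexx => /(_ isT) nxy.
by apply/eqP; move: nxy; rewrite lt_neqAle xy andbT negbK eq_sym.
Qed.

Lemma principal_split x : exists s, filter_of s = [set z | x <= z].
Proof. by apply: split_exists => y z yz /=; move/le_trans; exact. Qed.

(** If [y] covers [x], then removing [x] from its principal filter makes
[y] minimal, so there is a path of color [kappa x] and then [kappa y]. The first
element removed along any path from that filter is [x], so the swapped path does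
not exist when the two colors are distant. *)
Lemma steps_NA : no_repeated_step kappa -> distant_steps_swap -> NA adj kappa.
Proof.
move=> norep swap; suff cov x y : covers x y -> adj (kappa x) (kappa y).
  by move=> x y [/cov//|/cov]; rewrite adj_sym.
move=> [xy cxy].
have [s sE] := principal_split x; have [minx uniqx] := principal_minimal sE.
have mx := minimal_move minx; have [_ tE] := mx.
set t := filter_to_ideal s x in mx tE.
have miny : minimal_in (filter_of t) y.
  rewrite tE sE; split=> [|z [/= xz zx]].
    by split; [exact: ltW | move=> /= yx; rewrite yx ltxx in xy].
  apply/negP => zy; move: (cxy z); rewrite zy andbT lt_neqAle xz andbT negbK => /eqP xz'.
  exact: zx.
have stx : step (kappa x) s t by exists x.
have sty := minimal_step kappa miny.
apply: contrapT => nadj; have [E|nE] := eqVneq (kappa x) (kappa y).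
  by move: sty; rewrite -E; exact: norep stx.
have dist : distant adj (kappa x) (kappa y) by rewrite /distant nE; exact/negP.
have [t' [z zy mz]] := swap _ _ _ _ _ dist stx sty.
by move: nE; rewrite -zy (uniqx z) ?eqxx//; exact: move_minimal mz.
Qed.

Section Weights.
Local Open Scope ring_scope.
Variable h : G -> fi_split P -> int.

Definition weight_shift := forall a b s t,
  step a s t -> h b t = h b s + theta adj a b.

Hypothesis h_shift : weight_shift.

(** A finite set whose removal leaves a filter can be removed one minimal
element at a time, and each removal contributes its own shift. *)
Lemma weight_path b s t (D : seq P) : uniq D ->
  (forall z, z \in D -> filter_of s z) ->
  filter_of t = filter_of s `\` [set` D] ->
  h b t = h b s + \sum_(z <- D) theta adj (kappa z) b.
Proof.
have [n] := ubnP (size D); elim: n => // n IHn in s D *; rewrite ltnS => szD uD Ds tE.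
case: D => [|x0 D0] in szD uD Ds tE *.
  by rewrite big_nil addr0; congr h; apply: split_ext; rewrite tE set_nil setD0.
move: szD uD Ds tE; have : x0 \in x0 :: D0 := mem_head _ _.
move: (x0 :: D0) => D x0D szD uD Ds tE.
have [m mD [_ minm]] := seq_minimal (@ltxx _ P) (@lt_trans _ P) x0D.
have Mm : minimal_in (filter_of s) m.
  split=> [|y sy]; first exact: Ds.
  have [/minm//|yD] := boolP (y \in D).
  apply/negP => ym; have ty : filter_of t y by rewrite tE; split=> //=; apply/negP.
  have := split_upward (ltW ym) ty; rewrite tE => -[_] /=; exact.
have mm := minimal_move Mm; have [_ s'E] := mm.
set s' := filter_to_ideal s m in mm s'E.
rewrite (IHn s' (rem m D)).
- rewrite (h_shift b (ex_intro2 _ _ m erefl mm)) -addrA; congr (_ + _).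
  by rewrite (perm_big _ (perm_to_rem mD)) big_cons.
- have D0_gt0 : (0 < size D)%N by case: (D) x0D.
  by rewrite size_rem// prednK.
- exact: rem_uniq.
- move=> z; rewrite mem_rem_uniq// inE => /andP[/= /eqP zm zD].
  by rewrite s'E; split=> //; exact: Ds.
- rewrite tE s'E setDDl; congr (_ `\` _); apply/seteqP; split=> z /=.
    have [->|zm zD] := eqVneq z m; first by left.
    by right; rewrite /= mem_rem_uniq// inE zm.
  by case=> [->//|]; rewrite /= mem_rem_uniq// inE => /andP[].
Qed.

Lemma sum_theta a (D : seq P) : \sum_(z <- D) theta adj (kappa z) a =
  2 *+ count (fun z => kappa z == a) D - (count (fun z => adj a (kappa z)) D)%:Z.
Proof.
elim: D => [|z D IH]; first by rewrite big_nil.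
rewrite big_cons IH /= /theta adj_sym.
have [->|_] := eqVneq (kappa z) a; first by rewrite adj_irr; lia.
by case: (adj a (kappa z)) => /=; lia.
Qed.

Lemma weight_path_color a s t (D : seq P) x : uniq D ->
  (forall z, z \in D -> filter_of s z) ->
  filter_of t = filter_of s `\` [set` D] ->
  x \in D -> kappa x = a -> (forall z, z \in D -> kappa z = a -> z = x) ->
  h a t = h a s + 2 - (count (fun z => adj a (kappa z)) D)%:Z.
Proof.
move=> uD Ds tE xD xa onlyx; rewrite (weight_path a uD Ds tE) sum_theta.
suff -> : count (fun z => kappa z == a) D = 1%N by rewrite addrA.
rewrite (@eq_in_count _ _ (pred1 x)) ?count_uniq_mem ?xD// => z zD /=.
by apply/eqP/eqP => [/onlyx->//|->].
Qed.

Lemma count_ge2 (p : pred P) (D : seq P) z1 z2 :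
  z1 \in D -> z2 \in D -> z1 <> z2 -> p z1 -> p z2 -> (2 <= count p D)%N.
Proof.
move=> z1D z2D /eqP z12 p1 p2; rewrite -size_filter.
apply: (@uniq_leq_size _ [:: z1; z2]); first by rewrite /= inE z12.
by move=> z; rewrite !inE mem_filter => /orP[/eqP->|/eqP->]; apply/andP.
Qed.

Definition minimal_weight := forall a s, h a s = -1 <-> exists t, step a s t.

Hypothesis h_minimal : minimal_weight.

Lemma weight_minimal x s : minimal_in (filter_of s) x -> h (kappa x) s = -1.
Proof. by move=> mx; apply/h_minimal; eexists; exact: minimal_step. Qed.

(** The half-open interval from [x] to [y] contains no element of color
[a] besides [x]. Removing it from the principal filter of [x] turns a filter with
minimal element [x] into one with minimal element [y], both of weight [-1]. The
balance [-1 + 2 - n = -1] gives [n = 2]. *)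
Lemma weights_I2A : I2A adj kappa.
Proof.
move=> a x y [/= xa ya xy cons].
have [s sE] := principal_split x; have [minx _] := principal_minimal sE.
have [|D uD DE] := @finite_uniq_seq _ _ [set z | (x <= z < y)%O].
  by apply: sub_finite_set (P_lf x y) => z /= /andP[-> /ltW ->].
have inD z : z \in D = (x <= z < y)%O.
  by apply/idP/idP; rewrite -[is_true (z \in D)]/([set` D] z) -DE.
have [t tE] : exists t : fi_split P, filter_of t = filter_of s `\` [set` D].
  apply: split_exists => z w zw; rewrite sE /= !inD => -[xz nz].
  split; first exact: le_trans zw.
  by move=> /andP[_ wy]; apply: nz; rewrite xz; exact: le_lt_trans wy.
have miny : minimal_in (filter_of t) y.
  rewrite tE sE; split=> [|z [/= xz]].
    by split; [exact: ltW | rewrite /= inD ltxx andbF].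
  by rewrite inD xz => /negP.
have Ds z : z \in D -> filter_of s z by rewrite inD sE => /andP[].
have xD : x \in D by rewrite inD lexx.
have onlyx z : z \in D -> kappa z = a -> z = x.
  rewrite inD => /andP[xz zy] za; apply: contrapT => zx.
  by move: (cons z za); rewrite zy andbT lt_neqAle xz andbT negbK => /eqP/esym.
have := weight_path_color uD Ds tE xD xa onlyx.
have := weight_minimal minx; rewrite xa => ->.
have := weight_minimal miny; rewrite ya => -> E.
have c2 : count (fun z => adj a (kappa z)) D = 2%N by lia.
have -> : [set z | (x < z < y)%O /\ adj a (kappa z)] =
    [set` [fset z in [seq z <- D | adj a (kappa z)]]%fset].
  apply/seteqP; split=> z /=; rewrite !inE mem_filter inD.
    by move=> [/andP[xz ->] ->]; rewrite (ltW xz).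
  move=> /and3P[az xz zy]; split=> //; rewrite zy andbT lt_neqAle xz andbT.
  by apply/eqP => xz'; rewrite -xz' xa adj_irr in az.
apply/card_eq_fsetP; rewrite card_fseq undup_id ?filter_uniq//.
by rewrite size_filter.
Qed.

(** If [x] and [y] have adjacent colors and are incomparable, both are
minimal in the filter they generate, and removing [x] lowers the weight of
[kappa y] from [-1] to [-2]. *)
Lemma weights_AC : (forall a s, -1 <= h a s) -> Defs.AC adj kappa.
Proof.
move=> hge x y axy; apply: contrapT => ncmp.
have [s [minx miny]] := incomparable_minimal ncmp.
have E := h_shift (kappa y) (minimal_step kappa minx).
have := hge (kappa y) (filter_to_ideal s x).
rewrite E (weight_minimal miny) /theta axy; case: eqP axy => [->|_ _ //].
by rewrite adj_irr.
Qed.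

(** Suppose that [z1] and [z2] violate the property. Removing from the
principal filter of [x] everything below [z1] or [z2] takes the weight from [-1]
to [1 - n] with [n >= 2], hence to [-1]. The filter that remains then has a
minimal element of color [a], although [x] was maximal in its color. *)
Lemma weights_Mx1GA : (forall a s, -1 <= h a s) -> Mx1GA adj kappa.
Proof.
move=> hge a x [xa maxx] z1 z2 [/= xz1 az1] [/= xz2 az2]; apply: contrapT => z12.
have [s sE] := principal_split x; have [minx _] := principal_minimal sE.
have [|D uD DE] := @finite_uniq_seq _ _ [set z | (x <= z <= z1)%O \/ (x <= z <= z2)%O].
  by rewrite -/([set z | (x <= z <= z1)%O] `|` [set z | (x <= z <= z2)%O]) finite_setU.
have inD z : z \in D <-> (x <= z <= z1)%O \/ (x <= z <= z2)%O.
  by rewrite -[is_true (_ \in _)]/([set` D] z) -DE.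
have [t tE] : exists t : fi_split P, filter_of t = filter_of s `\` [set` D].
  apply: split_exists => z w zw; rewrite sE /= !inD => -[xz nz].
  split; first exact: le_trans zw.
  by case=> /andP[_ wy]; apply: nz; [left|right]; rewrite xz; exact: le_trans wy.
have Ds z : z \in D -> filter_of s z by rewrite inD sE => -[]/andP[].
have xD : x \in D by apply/inD; left; rewrite lexx ltW.
have onlyx z : z \in D -> kappa z = a -> z = x.
  move=> /Ds; rewrite sE /= => xz za; move: (maxx z za).
  by rewrite lt_neqAle xz andbT negbK => /eqP.
have := weight_path_color uD Ds tE xD xa onlyx.
have := weight_minimal minx; rewrite xa => ->.
have : (2 <= count (fun z => adj a (kappa z)) D)%N.
  apply: (@count_ge2 _ _ z1 z2) => //; apply/inD; [left|right]; rewrite lexx andbT ltW//.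
move=> c2 E; have /h_minimal[u [y ya my]] : h a t = -1 by have := hge a t; lia.
have := my.1; rewrite tE sE => -[/= xy yD]; apply: yD.
suff -> : y = x by [].
by move: (maxx y ya); rewrite lt_neqAle xy andbT negbK => /eqP.
Qed.

Lemma weights_d_complete : no_repeated_step kappa -> distant_steps_swap ->
  (forall a s, -1 <= h a s) -> colored_d_complete adj kappa.
Proof.
move=> norep swap hge; split.
- exact: no_repeated_step_EC.
- exact: steps_NA.
- exact: weights_AC.
- exact: weights_I2A.
- exact: weights_Mx1GA.
Qed.

Definition maximal_weight := forall a s, h a s = 1 <-> exists r, step a r s.

(** The mirror image of [weights_Mx1GA]: the path ends at the split whose
ideal is generated by [y], where the weight is [1], and starts where everything
above [z1] or [z2] is still in the filter. *)
Lemma weights_Mn1LA : (forall a s, h a s <= 1) -> maximal_weight -> Mn1LA adj kappa.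
Proof.
move=> hle hmax a y [ya miny] z1 z2 [/= yz1 az1] [/= yz2 az2]; apply: contrapT => z12.
have [|D uD DE] := @finite_uniq_seq _ _ [set z | (z1 <= z <= y)%O \/ (z2 <= z <= y)%O].
  by rewrite -/([set z | (z1 <= z <= y)%O] `|` [set z | (z2 <= z <= y)%O]) finite_setU.
have inD z : z \in D <-> (z1 <= z <= y)%O \/ (z2 <= z <= y)%O.
  by rewrite -[is_true (_ \in _)]/([set` D] z) -DE.
have [t tE] : exists t : fi_split P, filter_of t = [set z | ~~ (z <= y)%O].
  apply: split_exists => z w zw /=; apply: contra; exact: le_trans.
have [s sE] : exists s : fi_split P, filter_of s = filter_of t `|` [set` D].
  apply: split_exists => z w zw; rewrite tE => -[/= nz|/= zD].
    by left; apply: contra nz; exact: le_trans.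
  have [wy|nwy] := boolP (w <= y)%O; [right | by left].
  by move/inD: zD => [] /andP[zz _]; apply/inD; [left|right];
    rewrite wy andbT (le_trans zz zw).
have Ds z : z \in D -> filter_of s z by rewrite sE; right.
have tE' : filter_of t = filter_of s `\` [set` D].
  rewrite sE setDUl setDv setU0 setDidl//; apply/disjoints_subset => z.
  by rewrite tE /= => nz /inD[]/andP[_]; exact/negP.
have yD : y \in D by apply/inD; left; rewrite lexx andbT ltW.
have onlyy z : z \in D -> kappa z = a -> z = y.
  move=> /inD zD za; have zy : (z <= y)%O by case: zD => /andP[].
  by move: (miny z za); rewrite lt_neqAle zy andbT negbK => /eqP.
have c2 : (2 <= count (fun z => adj a (kappa z)) D)%N.
  apply: (@count_ge2 _ _ z1 z2) => //; apply/inD; [left|right]; rewrite lexx/= ltW//.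
have maxy : maximal_in (ideal_of t) y.
  split=> [|z /split_idealP]; first by apply/split_idealP; rewrite tE /= lexx.
  rewrite tE /= => /negP; rewrite negbK => zy.
  by apply/negP => /lt_le_trans/(_ zy); rewrite ltxx.
have ht : h a t = 1 by apply/hmax; rewrite -ya; eexists; exact: maximal_step maxy.
have E := weight_path_color uD Ds tE' yD ya onlyy.
have /hmax[r [w wa mw]] : h a s = 1 by have := hle a s; lia.
have [/split_idealP sw _] := move_maximal mw.
apply: sw; rewrite sE.
have [wy|nwy] := boolP (w <= y)%O; last by left; rewrite tE.
suff -> : w = y by right.
by move: (miny w wa); rewrite lt_neqAle wy andbT negbK => /eqP.
Qed.

End Weights.

End Necessity.

(** * Counting elements color by color *)

Section Sufficiency.
Context (G : finType) (adj : rel G).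
Hypotheses (adj_sym : symmetric adj) (adj_irr : irreflexive adj).
Context {d : Order.disp_t} {P : porderType d}.
Hypothesis P_lf : locally_finite P.
Context (kappa : P -> G).
Implicit Types (a b : G) (s t r : fi_split P) (x y z u v w p q : P) (A : set P).
Local Open Scope order_scope.
Local Open Scope classical_set_scope.

Notation step := (step kappa).

(** Colors that occur infinitely often count for [1], so that the count
still vanishes on the empty set only. *)
Definition color_count A a : nat :=
  if pselect (finite_set (A `&` color_class kappa a))
  then #|` fset_set (A `&` color_class kappa a) |%fset else 1.

(** A regularized cardinal: it equals the number of elements of a finite
set, and on an infinite set it still drops by one when an element is removed
whose color occurs only finitely often in it. *)
Definition reg_count A : nat := (\sum_(a : G) color_count A a)%N.

Lemma reg_count0 : reg_count set0 = 0%N.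
Proof.
apply: big1 => a _; rewrite /color_count set0I fset_set0 cardfs0.
by case: pselect => // -[]; exact: finite_set0.
Qed.

Lemma reg_count_eq0 A : reg_count A = 0%N -> A = set0.
Proof.
move=> /eqP; rewrite /reg_count sum_nat_eq0 => /forallP cA.
apply: contrapT => /eqP/set0P[z Az]; have /= := cA (kappa z).
rewrite /color_count; case: pselect => // fin.
have : z \in fset_set (A `&` color_class kappa (kappa z)).
  by rewrite in_fset_set//; apply/mem_set.
by move=> zA /eqP/cardfs0_eq E; rewrite E inE in zA.
Qed.

Lemma reg_countD1 A z : A z -> finite_set (A `&` color_class kappa (kappa z)) ->
  reg_count A = (reg_count (A `\ z)).+1.
Proof.
move=> Az fin; rewrite /reg_count (bigD1 (kappa z))// [in RHS](bigD1 (kappa z))//=.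
rewrite -addSn; congr (_ + _)%N.
  have E : (A `\ z) `&` color_class kappa (kappa z) =
           (A `&` color_class kappa (kappa z)) `\ z by rewrite !setDE setIAC.
  rewrite /color_count E; case: pselect => [?|[]//]; case: pselect => [?|[]].
    by rewrite fset_setD1// [in LHS](cardfsD1 z) in_fset_set// mem_set.
  exact: finite_setD.
apply: eq_bigr => a az; rewrite /color_count.
suff -> : (A `\ z) `&` color_class kappa a = A `&` color_class kappa a by [].
apply/seteqP; split=> w [Aw wa]; first by split=> //; case: Aw.
by split=> //; split=> // /= wz; rewrite -wa wz eqxx in az.
Qed.

Lemma reg_count1 x : reg_count [set x] = 1%N.
Proof.
rewrite (@reg_countD1 _ x)//; last exact: finite_setIl.
by rewrite setDv reg_count0.
Qed.

Lemma reg_count2 x y : x <> y -> reg_count [set x; y] = 2%N.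
Proof.
move=> xy; rewrite (@reg_countD1 _ x); first last.
- exact: finite_setIl (finite_set2 _ _).
- by left.
rewrite setDUl setDv set0U setDidl ?reg_count1//; apply/disjoints_subset => z -> /=.
exact/nesym.
Qed.

Lemma is_subset1_set0_or_set1 A : is_subset1 A -> A = set0 \/ exists x, A = [set x].
Proof.
move=> A1; have [->|/set0P[x Ax]] := eqVneq A set0; [by left | right; exists x].
by apply/seteqP; split=> [y Ay|y ->//]; exact: A1.
Qed.

Lemma reg_count_subset1 A : is_subset1 A -> (reg_count A <= 1)%N.
Proof.
by move=> /is_subset1_set0_or_set1[->|[x ->]]; rewrite ?reg_count0 ?reg_count1.
Qed.

Lemma is_subset1_finite A : is_subset1 A -> finite_set A.
Proof. by move=> /is_subset1_set0_or_set1[->|[x ->]]; [exact: finite_set0|]. Qed.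

Lemma card_two (A : set P) : (A #= `I_2)%card -> exists x y, x <> y /\ A = [set x; y].
Proof.
move=> A2; have fin : finite_set A by exists 2%N.
have [D uD AD] := finite_uniq_seq fin.
have : #|` [fset z in D]%fset | = 2%N.
  apply/card_eq_fsetP; suff -> : [set` [fset z in D]%fset] = A by [].
  by rewrite AD; apply/seteqP; split=> z /=; rewrite inE.
rewrite card_fseq undup_id//.
case: D uD AD => [|x [|y [|]]]//=; rewrite andbT inE => /eqP xy -> _.
exists x, y; split=> //; apply/seteqP; split=> z /=; rewrite !inE.
  by move=> /orP[/eqP|/eqP]; [left | right].
by case=> ->; rewrite eqxx ?orbT.
Qed.

(** * The weight of a split *)

Definition lowest a s v := minimal_in (filter_of s `&` color_class kappa a) v.
Definition highest a s u := maximal_in (ideal_of s `&` color_class kappa a) u.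
Definition adj_below a s v := [set z | [/\ filter_of s z, z < v & adj a (kappa z)]].
Definition adj_above a s u := [set z | [/\ ideal_of s z, u < z & adj a (kappa z)]].

Section Weight.
Local Open Scope ring_scope.

Definition weight a s : int :=
  match pselect (exists v, lowest a s v), pselect (exists u, highest a s u) with
  | left ev, _ => (reg_count (adj_below a s (projT1 (cid ev))))%:Z - 1
  | right _, left eu => 1 - (reg_count (adj_above a s (projT1 (cid eu))))%:Z
  | right _, right _ => 0
  end.

End Weight.

Hypotheses (ec : EC kappa) (na : NA adj kappa) (ac : Defs.AC adj kappa).
Hypotheses (i2a : I2A adj kappa) (mx1ga : Mx1GA adj kappa).

Lemma lowest_le a s v z : lowest a s v -> filter_of s z -> kappa z = a -> v <= z.
Proof.
move=> [[sv va] minv] sz za; have /orP[//|] : v >=< z by apply: ec; rewrite va za.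
by rewrite le_eqVlt (negPf (minv z _))// orbF => /eqP ->.
Qed.

Lemma highest_ge a s u z : highest a s u -> ideal_of s z -> kappa z = a -> z <= u.
Proof.
move=> [[su ua] maxu] sz za; have /orP[|//] : u >=< z by apply: ec; rewrite ua za.
by rewrite le_eqVlt (negPf (maxu z _))// orbF => /eqP ->.
Qed.

(** A lower bound [w] confines the elements of color [a] below [p] to a
finite interval. *)
Lemma lowest_exists a s p w : filter_of s p -> kappa p = a ->
  (forall q, filter_of s q -> kappa q = a -> w <= q) -> exists v, lowest a s v.
Proof.
move=> sp pa wle.
have fin : finite_set [set q | (filter_of s `&` color_class kappa a) q /\ q <= p].
  by apply: sub_finite_set (P_lf w p) => q /= [[sq qa] ->]; rewrite wle.
have [|m mp [[Sm _] minm]] := finite_minimal fin (_ : _ p); first by split.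
exists m; split=> // q Sq; apply/negP => qm.
have : ~~ (q < m) by apply: minm; split=> //; exact: ltW (lt_le_trans qm mp).
by rewrite qm.
Qed.

Lemma highest_exists a s p w : ideal_of s p -> kappa p = a ->
  (forall q, ideal_of s q -> kappa q = a -> q <= w) -> exists u, highest a s u.
Proof.
move=> sp pa wge.
have fin : finite_set [set q | (ideal_of s `&` color_class kappa a) q /\ p <= q].
  by apply: sub_finite_set (P_lf p w) => q /= [[sq qa] ->]; rewrite wge.
have [|m pm [[Sm _] maxm]] := finite_maximal fin (_ : _ p); first by split.
exists m; split=> // q Sq; apply/negP => mq.
have : ~~ (m < q) by apply: maxm; split=> //; exact: ltW (le_lt_trans pm mq).
by rewrite mq.
Qed.

Lemma comparable_ideal_filter s x y : x >=< y -> ideal_of s x -> filter_of s y -> x < y.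
Proof.
move=> xy /split_idealP nsx sy; rewrite lt_neqAle.
case/orP: xy => [->|yx]; last by case: nsx; exact: split_upward yx sy.
by rewrite andbT; apply/eqP => E; apply: nsx; rewrite E.
Qed.

Lemma comparable_minimal s x y : x >=< y -> minimal_in (filter_of s) x ->
  filter_of s y -> x <= y.
Proof.
move=> /orP[//|]; rewrite le_eqVlt => /orP[/eqP -> //|yx] [_ minx] /minx.
by rewrite yx.
Qed.

Lemma lowest_from_split a s u p : ideal_of s u -> kappa u = a ->
  filter_of s p -> kappa p = a -> exists v, lowest a s v.
Proof.
move=> su ua sp pa; apply: lowest_exists sp pa (_ : forall q, _ -> _ -> u <= q) => q sq qa.
by apply/ltW/(comparable_ideal_filter _ su sq)/ec; rewrite ua qa.
Qed.

Lemma highest_from_split a s u p : ideal_of s u -> kappa u = a ->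
  filter_of s p -> kappa p = a -> exists v, highest a s v.
Proof.
move=> su ua sp pa; apply: highest_exists su ua (_ : forall q, _ -> _ -> q <= p) => q sq qa.
by apply/ltW/(comparable_ideal_filter _ sq sp)/ec; rewrite pa qa.
Qed.

Lemma minimal_lowest x s : minimal_in (filter_of s) x -> lowest (kappa x) s x.
Proof. by move=> [sx minx]; split=> // y [sy _]; exact: minx. Qed.

Lemma maximal_highest x s : maximal_in (ideal_of s) x -> highest (kappa x) s x.
Proof. by move=> [sx minx]; split=> // y [sy _]; exact: minx. Qed.

(** An element of the filter below [v] would produce one covered by [v],
whose color is adjacent to that of [v]. *)
Lemma adj_below_minimal a s v : lowest a s v -> adj_below a s v = set0 ->
  minimal_in (filter_of s) v.
Proof.
move=> [[sv va] _] E; split=> // y sy; apply/negP => /(cover_below P_lf)[z yz zv].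
suff : adj_below a s v z by rewrite E.
split; [exact: split_upward sy | exact: zv.1 | rewrite -va].
by apply: na; right.
Qed.

Lemma adj_above_maximal a s u : highest a s u -> adj_above a s u = set0 ->
  maximal_in (ideal_of s) u.
Proof.
move=> [[su ua] _] E; split=> // y sy; apply/negP => /(cover_above P_lf)[z zy uz].
suff : adj_above a s u z by rewrite E.
split; [|exact: uz.1|by rewrite -ua; apply: na; left].
by move/split_idealP: sy => sy; apply/split_idealP => sz; apply: sy; exact: split_upward sz.
Qed.

Lemma minimal_adj_below a s v : minimal_in (filter_of s) v -> adj_below a s v = set0.
Proof.
by move=> [_ minv]; apply/seteqP; split=> // z [sz zv _]; have := minv z sz; rewrite zv.
Qed.

Lemma maximal_adj_above a s u : maximal_in (ideal_of s) u -> adj_above a s u = set0.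
Proof.
by move=> [_ maxu]; apply/seteqP; split=> // z [sz zv _]; have := maxu z sz; rewrite zv.
Qed.

(** When no element of color [a] is left in the filter, [u] is maximal in
its color in the whole poset and Mx1GA applies. *)
Lemma adj_above_subset1 a s u : ~ (exists v, lowest a s v) -> highest a s u ->
  is_subset1 (adj_above a s u).
Proof.
move=> nolow hu; have [[su ua] maxu] := hu.
have maxu' : maximal_in (color_class kappa a) u.
  split=> // q qa; have [sq|/split_idealP sq] := EM (filter_of s q); last exact: maxu.
  by case: nolow; exact: lowest_from_split su ua sq qa.
by move=> x y [_ ux ax] [_ uy ay]; exact: mx1ga maxu' x y (conj ux ax) (conj uy ay).
Qed.

Lemma consecutive_highest_lowest a s u v : highest a s u -> lowest a s v ->
  consecutive kappa a u v.
Proof.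
move=> hu lv; have [[su ua] maxu] := hu; have [[sv va] minv] := lv.
split=> //; first by apply: comparable_ideal_filter su sv; apply: ec; rewrite ua va.
move=> z za; apply/negP => /andP[uz zv].
have [sz|/split_idealP sz] := EM (filter_of s z).
  by have := minv z (conj sz za); rewrite zv.
by have := maxu z (conj sz za); rewrite uz.
Qed.

Section WeightLemmas.
Local Open Scope ring_scope.

Lemma weight_lowest a s v : lowest a s v ->
  weight a s = (reg_count (adj_below a s v))%:Z - 1.
Proof.
move=> lv; rewrite /weight; case: pselect => [ev|[]]; last by exists v.
case: cid => v' lv' /=; suff -> : v' = v by [].
by apply: le_anti; rewrite (lowest_le lv lv'.1.1 lv'.1.2) (lowest_le lv' lv.1.1 lv.1.2).
Qed.

Lemma weight_highest a s u : ~ (exists v, lowest a s v) -> highest a s u ->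
  weight a s = 1 - (reg_count (adj_above a s u))%:Z.
Proof.
move=> nolow hu; rewrite /weight; case: pselect => // _.
case: pselect => [eu|[]]; last by exists u.
case: cid => u' hu' /=; suff -> : u' = u by [].
by apply: le_anti; rewrite (highest_ge hu hu'.1.1 hu'.1.2) (highest_ge hu' hu.1.1 hu.1.2).
Qed.

Lemma weight_none a s : ~ (exists v, lowest a s v) -> ~ (exists u, highest a s u) ->
  weight a s = 0.
Proof. by move=> nolow nohigh; rewrite /weight; do 2 case: pselect => //. Qed.

Variant weight_spec a s : int -> Type :=
  | WeightLowest v of lowest a s v :
      weight_spec a s ((reg_count (adj_below a s v))%:Z - 1)
  | WeightHighest u of ~ (exists v, lowest a s v) & highest a s u :
      weight_spec a s (1 - (reg_count (adj_above a s u))%:Z)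
  | WeightNone of ~ (exists v, lowest a s v) & ~ (exists u, highest a s u) :
      weight_spec a s 0.

Lemma weightP a s : weight_spec a s (weight a s).
Proof.
have [/cid[v lv]|nolow] := pselect (exists v, lowest a s v).
  by rewrite (weight_lowest lv); constructor.
have [/cid[u hu]|nohigh] := pselect (exists u, highest a s u).
  by rewrite (weight_highest nolow hu); constructor.
by rewrite weight_none//; constructor.
Qed.

Lemma weight_of_minimal x s : minimal_in (filter_of s) x -> weight (kappa x) s = -1.
Proof.
move=> minx; rewrite (weight_lowest (minimal_lowest minx)).
by rewrite minimal_adj_below// reg_count0.
Qed.

(** If [x] has a successor [v] in its color, then the elements between
them with adjacent color all lie in the filter, and there are two of them by
I2A; this makes the two formulas for the weight agree. *)
Lemma weight_of_maximal x s : maximal_in (ideal_of s) x -> weight (kappa x) s = 1.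
Proof.
move=> maxx; have hx := maximal_highest maxx.
have [[v lv]|nolow] := EM (exists v, lowest (kappa x) s v); last first.
  by rewrite (weight_highest nolow hx) maximal_adj_above// reg_count0.
rewrite (weight_lowest lv).
have := i2a (consecutive_highest_lowest hx lv).
have -> : [set z | (x < z < v)%O /\ adj (kappa x) (kappa z)] = adj_below (kappa x) s v.
  have [_ maxx'] := maxx; apply/seteqP; split=> z.
    move=> [/andP[xz zv] az]; split=> //; apply: contrapT => /split_idealP sz.
    by have := maxx' z sz; rewrite xz.
  move=> [sz zv az]; split=> //; rewrite zv andbT.
  exact: comparable_ideal_filter (ac az) hx.1.1 sz.
by move=> /card_two[y [z [yz ->]]]; rewrite reg_count2.
Qed.

Hypothesis kappa_surj : forall a : G, exists x : P, kappa x = a.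

(** Let [z] be the element that is moved. If [z] has color [a], the weight
goes from [-1] to [1]. Otherwise the elements of color [a] stay in place, and so
does the reference element of the weight, the [v] or [u] of its formula. If
moreover the color of [z] is adjacent to [a], then [z] is comparable to the
reference element and so enters or leaves the set that is counted. In that case
the filter has a least or the ideal a greatest element of color [a]: otherwise
[z] would bound an infinite chain of color [a], against local finiteness. *)
Lemma weight_shiftP : weight_shift adj kappa weight.
Proof.
move=> b a s t [z zb mz]; rewrite /theta.
have [ba|ba] := eqVneq b a.
  rewrite -ba -zb (weight_of_minimal (move_minimal mz)).
  by rewrite (weight_of_maximal (move_maximal mz)).
have za : kappa z != a by rewrite zb.
have [sz tE] := mz; have sE := move_filter_source mz.
have minz := move_minimal mz; have [_ minz'] := minz.
have Fa : filter_of t `&` color_class kappa a = filter_of s `&` color_class kappa a.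
  rewrite tE; apply/seteqP; split=> w [Sw wa]; first by split=> //; case: Sw.
  by split=> //; split=> // /= wz; rewrite -wz wa eqxx in za.
have Ia : ideal_of t `&` color_class kappa a = ideal_of s `&` color_class kappa a.
  rewrite !split_idealE tE; apply/seteqP; split=> w [Sw wa]; split=> //.
    by move=> sw; apply: Sw; split=> // /= wz; rewrite -wz wa eqxx in za.
  by move=> [sw _]; exact: Sw.
have lowE v : lowest a t v = lowest a s v by rewrite /lowest Fa.
have highE u : highest a t u = highest a s u by rewrite /highest Ia.
have nolow : ~ (exists v, lowest a s v) -> ~ (exists v, lowest a t v).
  by move=> H [v]; rewrite lowE => lv; apply: H; exists v.
have nohigh : ~ (exists v, highest a s v) -> ~ (exists v, highest a t v).
  by move=> H [v]; rewrite highE => lv; apply: H; exists v.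
have [ab|nab] := boolP (adj b a); last first.
  have nz : ~~ adj a (kappa z) by rewrite zb adj_sym.
  have belowE v : adj_below a t v = adj_below a s v.
    apply/seteqP; split=> w [Sw wv aw]; split=> //; first by rewrite sE; left.
    by rewrite tE; split=> // /= wz; rewrite wz (negPf nz) in aw.
  have aboveE u : adj_above a t u = adj_above a s u.
    apply/seteqP; split=> w [/split_idealP Sw wv aw]; split=> //; apply/split_idealP.
      by move=> sw; apply: Sw; rewrite tE; split=> // /= wz; rewrite wz (negPf nz) in aw.
    by rewrite tE => -[].
  rewrite addr0; case: (weightP a s) => [v lv|u nl hu|nl nh].
  - by rewrite (@weight_lowest a t v) ?lowE// belowE.
  - by rewrite (@weight_highest a t u) ?highE// ?aboveE//; exact: nolow.
  - by rewrite weight_none//; [exact: nolow | exact: nohigh].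
have az : adj a (kappa z) by rewrite zb adj_sym.
case: (weightP a s) => [v lv|u nl hu|nl nh].
(* The reference element is the least element [v]: the count drops by one. *)
- have zv : (z < v)%O.
    rewrite lt_neqAle (comparable_minimal _ minz lv.1.1) ?andbT; last first.
      by rewrite comparable_sym; apply: ac; rewrite lv.1.2.
    by apply/eqP => E; rewrite E lv.1.2 eqxx in za.
  rewrite (@weight_lowest a t v) ?lowE// (@reg_countD1 (adj_below a s v) z)//; last first.
    apply: sub_finite_set (P_lf z v) => w [[sw wv _] wz] /=; rewrite (ltW wv) andbT.
    by apply: comparable_minimal minz sw; apply: ec.
  suff -> : adj_below a s v `\ z = adj_below a t v by lia.
  rewrite /adj_below tE; apply/seteqP; split=> w; first by move=> [[]].
  by move=> [[sw wz] wv aw].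
(* The reference element is the greatest element [u]: the count grows by one. *)
- have Iz : ideal_of t z by case: (move_maximal mz).
  have uz : (u < z)%O.
    by apply: comparable_ideal_filter hu.1.1 sz; apply: ac; rewrite hu.1.2.
  have hu' : highest a t u by rewrite highE.
  rewrite (weight_highest (nolow nl) hu') (@reg_countD1 (adj_above a t u) z)//; last first.
    exact/finite_setIl/is_subset1_finite/(adj_above_subset1 (nolow nl) hu').
  suff -> : adj_above a t u `\ z = adj_above a s u by lia.
  rewrite /adj_above !split_idealE tE; apply/seteqP; split=> w.
    by move=> [[tw uw aw] wz]; split=> // sw; apply: tw.
  by move=> [sw uw aw]; split; [split=> // -[] | move=> /= wz; rewrite wz in sw].
- exfalso; have [p pa] := kappa_surj a.
  have [sp|/split_idealP sp] := EM (filter_of s p).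
    apply: nl; apply: lowest_exists sp pa (_ : forall q, _ -> _ -> (z <= q)%O) => q sq qa.
    by apply: comparable_minimal minz sq; rewrite comparable_sym; apply: ac; rewrite qa.
  apply: nh; apply: highest_exists sp pa (_ : forall q, _ -> _ -> (q <= z)%O) => q sq qa.
  by apply/ltW; apply: comparable_ideal_filter sq sz; apply: ac; rewrite qa.
Qed.

Lemma weight_ge_opp1 a s : -1 <= weight a s.
Proof.
case: (weightP a s) => [v lv|u nl hu|nl nh] //; first by lia.
by have := reg_count_subset1 (adj_above_subset1 nl hu); lia.
Qed.

Lemma weight_minimalP : minimal_weight kappa weight.
Proof.
move=> a s; split=> [|[t [x <- mx]]]; last exact: weight_of_minimal (move_minimal mx).
case: (weightP a s) => [v lv|u nl hu|nl nh] //.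
  move=> E; have /reg_count_eq0/(adj_below_minimal lv)/(minimal_step kappa) :
    reg_count (adj_below a s v) = 0%N by lia.
  by rewrite lv.1.2; eexists; eassumption.
by have := reg_count_subset1 (adj_above_subset1 nl hu); lia.
Qed.

(** An element of color [a] in the ideal, together with [v], would give
the ideal a greatest element of that color. *)
Lemma lowest_no_highest_minimal a s v : lowest a s v -> ~ (exists u, highest a s u) ->
  minimal_in (color_class kappa a) v.
Proof.
move=> lv nh; split=> [|q qa]; first exact: lv.1.2.
have [sq|/split_idealP sq] := EM (filter_of s q); first exact: lv.2.
by case: nh; exact: highest_from_split sq qa lv.1.1 lv.1.2.
Qed.

Lemma adj_below_subset2 a s u v : highest a s u -> lowest a s v ->
  adj_below a s v `<=` [set z | (u < z < v)%O /\ adj a (kappa z)].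
Proof.
move=> hu lv z [sz zv az]; split=> //; rewrite zv andbT.
by apply: comparable_ideal_filter hu.1.1 sz; apply: ac; rewrite hu.1.2.
Qed.

Lemma reg_count_sub2 A x y : A `<=` [set x; y] ->
  (reg_count A <= 2)%N /\ (reg_count A = 2%N -> A = [set x; y]).
Proof.
move=> Axy.
have [Ax|nAx] := EM (A x); have [Ay|nAy] := EM (A y); last first.
- have -> : A = set0 by apply/seteqP; split=> // z Az; have := Az; case: (Axy z Az) => ->.
  by rewrite reg_count0.
- suff -> : A = [set y] by rewrite reg_count1.
  by apply/seteqP; split=> [z Az|z ->//]; have := Az; case: (Axy z Az) => ->.
- suff -> : A = [set x] by rewrite reg_count1.
  by apply/seteqP; split=> [z Az|z ->//]; have := Az; case: (Axy z Az) => ->.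
have -> : A = [set x; y] by apply/seteqP; split=> // z [->|->].
by split=> //; have [->|/eqP xy] := eqVneq x y; rewrite ?setUid ?reg_count1 ?reg_count2.
Qed.

Hypothesis mn1la : Mn1LA adj kappa.

Lemma adj_below_subset1 a s v : lowest a s v -> ~ (exists u, highest a s u) ->
  is_subset1 (adj_below a s v).
Proof.
move=> lv nh x y [_ xv ax] [_ yv ay].
exact: (mn1la (lowest_no_highest_minimal lv nh)) (conj xv ax) (conj yv ay).
Qed.

Lemma weight_le1 a s : weight a s <= 1.
Proof.
case: (weightP a s) => [v lv|u nl hu|nl nh] //; last by lia.
suff : (reg_count (adj_below a s v) <= 2)%N by lia.
have [[u hu]|nh] := EM (exists u, highest a s u); last first.
  exact: leq_trans (reg_count_subset1 (adj_below_subset1 lv nh)) _.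
have [x [y [_ E]]] := card_two (i2a (consecutive_highest_lowest hu lv)).
by have := adj_below_subset2 hu lv; rewrite E => /reg_count_sub2[].
Qed.

(** Weight [1] with a least element [v] of color [a] in the filter means
that two elements are counted below [v]. By Mn1LA this excludes that [v] is
minimal in its color; so [u] exists, and by I2A the two elements counted are all
those of adjacent color between [u] and [v]. None of them is in the ideal, which
leaves nothing in the ideal above [u]. *)
Lemma weight_maximalP : maximal_weight kappa weight.
Proof.
move=> a s; split=> [|[r [x <- mx]]]; last exact: weight_of_maximal (move_maximal mx).
suff H : weight a s = 1 -> exists2 u, highest a s u & maximal_in (ideal_of s) u.
  move=> /H[u hu] /(maximal_step kappa); rewrite hu.1.2; eexists; eassumption.
case: (weightP a s) => [v lv|u nl hu|nl nh] E; [|clear nl|lia]; last first.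
  exists u => //; apply: (adj_above_maximal hu); apply: reg_count_eq0; lia.
have [[u hu]|nh] := EM (exists u, highest a s u); last first.
  by have := reg_count_subset1 (adj_below_subset1 lv nh); lia.
exists u => //; apply: (adj_above_maximal hu); apply/seteqP; split=> // w [sw uw aw].
have [x [y [_ E2]]] := card_two (i2a (consecutive_highest_lowest hu lv)).
have sub := adj_below_subset2 hu lv; rewrite E2 in sub.
have [_ /(_ _)H] := reg_count_sub2 sub.
have : [set z | (u < z < v)%O /\ adj a (kappa z)] w.
  split=> //; rewrite uw /=; apply: comparable_ideal_filter sw lv.1.1.
  by rewrite comparable_sym; apply: ac; rewrite lv.1.2.
rewrite E2 -H; last by lia.
by move=> [sw' _ _]; move/split_idealP: sw.
Qed.

End WeightLemmas.

(** * Paths of steps in a d-complete poset *)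

(** Elements of equal color are comparable, so the second element moved
would cover the first, against NA and the irreflexivity of adjacency. *)
Lemma complete_no_repeated_step : no_repeated_step kappa.
Proof.
move=> a s t u [x xa mx] [y ya my].
have [cxy|ncov] := EM (covers x y).
  by have := na (or_introl cxy); rewrite xa ya adj_irr.
have [t' my'] := move_move_down mx my ncov.
have [sx minx] := move_minimal mx; have miny := move_minimal my'.
have xy : y <= x by apply: comparable_minimal miny sx; apply: ec; rewrite xa ya.
have [ty _] := move_minimal my; rewrite mx.2 in ty; case: ty => sy /= yx.
by have := minx y sy; rewrite lt_neqAle xy andbT; move/eqP: yx => ->.
Qed.

(** By NA an element of a distant color does not cover the first one, so
it can already be moved at the start. *)
Lemma complete_swap a b s t (u : fi_split P) : distant adj a b -> step a s t -> step b t u ->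
  exists2 t', step b s t' & step a t' u.
Proof.
move=> /andP[ab nab] sa sb; have [x xa mx] := sa; have [y yb my] := sb.
have ncov : ~ covers x y.
  by move=> cxy; have := na (or_introl cxy); rewrite xa yb; exact/negP.
have [t' my'] := move_move_down mx my ncov.
have sb' : step b s t' by exists y.
have [u' sb'' sa'] := step_diamond_down ab sa sb'.
by exists t' => //; rewrite (step_inj_r ec sb sb'').
Qed.

(** The two elements of color [a] would be consecutive with only the
element of color [b] between them, against I2A. *)
Lemma complete_no_sandwich a b s t (u w : fi_split P) : adj a b ->
  step a s t -> step b t u -> step a u w -> False.
Proof.
move=> ab [x xa mx] [y yb my] [z za mz].
have [uz minz] := move_minimal mz.
have tE := mx.2; have uE := my.2.
have [sz zx] : (filter_of s `\ x) z by rewrite -tE; move: uz; rewrite uE => -[].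
have xz : x < z.
  rewrite lt_neqAle (comparable_minimal _ (move_minimal mx) sz) ?andbT; last first.
    by apply: ec; rewrite xa za.
  by apply/eqP => /esym.
have only v : x < v < z -> v = y.
  move=> /andP[xv vz]; apply: contrapT => vy.
  suff uv : filter_of u v by have := minz v uv; rewrite vz.
  rewrite uE tE; split=> //; split; first exact: split_upward (ltW xv) mx.1.
  by move=> /= vx; rewrite vx ltxx in xv.
have cons : consecutive kappa a x z.
  split=> // v va; apply/negP => /only vy.
  by rewrite -yb -vy va adj_irr in ab.
have [p [q [pq E]]] := card_two (i2a cons).
have pE : p = y.
  by apply: only; have [] : [set v | x < v < z /\ adj a (kappa v)] p by rewrite E; left.
have qE : q = y.
  by apply: only; have [] : [set v | x < v < z /\ adj a (kappa v)] q by rewrite E; right.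
by apply: pq; rewrite pE qE.
Qed.

End Sufficiency.

(** * Operators and nonnegative coefficients *)

Section Operators.
Context (R : realType) (G : finType) (adj : rel G).
Hypotheses (adj_sym : symmetric adj) (adj_irr : irreflexive adj).
Context {d : Order.disp_t} {P : porderType d} (kappa : P -> G).
Implicit Types (s t u : fi_split P) (a b : G).
Local Open Scope ring_scope.

Local Notation C := R[i].
Local Notation V := {freeg (fi_split P) / C}.
Local Notation ket s := (<< s >> : V).
Local Notation X := (X_op R kappa).
Local Notation Y := (Y_op R kappa).
Local Notation step := (step kappa).
Local Notation brk := (@commutator R d P).

Lemma freeg_ketE (v : V) : v = \sum_(z <- dom v) coeff z v *: ket z.
Proof.
rewrite -{1}(freeg_sumE v); apply: eq_bigr => z _.
by apply/eqP/freeg_eqP => t; rewrite coeffZ !coeffU mul1r.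
Qed.

Lemma coeff_ket s t : coeff t (ket s) = (s == t)%:R.
Proof. by rewrite coeffU mul1r. Qed.

Lemma scale_ket_inj (c c' : C) s : c *: ket s = c' *: ket s -> c = c'.
Proof. by move/(congr1 (coeff s)); rewrite !coeffZ coeff_ket eqxx !mulr1. Qed.

(** Bare functions are compared, because the bracket of two linear maps is
formed in the space of all functions on [V]. *)
Lemma linear_ket_eq (f g : V -> V) : linear f -> linear g ->
  (forall s, f (ket s) = g (ket s)) -> f = g.
Proof.
move=> linf ling fg; apply/funext => v; rewrite (freeg_ketE v).
have zero k : linear k -> k (0 : V) = 0 :> V.
  by move=> link; have := link (-1) 0 0; rewrite scaler0 add0r scaleN1r addNr.
elim: (dom v) => [|z D IH]; first by rewrite big_nil !zero.
by rewrite big_cons linf ling IH fg.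
Qed.

Lemma linear_ket_eq0 (f : V -> V) : linear f -> (forall s, f (ket s) = 0) -> f = 0.
Proof.
by move=> linf f0; apply: linear_ket_eq => // c u v; rewrite scaler0 addr0.
Qed.

Lemma commutator_linear (f g : V -> V) : linear f -> linear g ->
  linear (commutator f g).
Proof.
move=> linf ling c u v; rewrite /commutator /=.
rewrite -![(_ - _) _]/(f (g _) - g (f _)) !(linf, ling) scalerBr.
by rewrite opprD addrACA.
Qed.

Lemma commutatorE (f g : V -> V) v : commutator f g v = f (g v) - g (f v).
Proof. by []. Qed.

(** Sums of basis vectors cannot cancel; this predicate, stable under
[X_a] and [Y_a], is how that is used. *)
Definition coeffs_ge0 (v : V) := forall t, 0 <= coeff t v.

Lemma coeffs_ge0_sum (I : Type) (D : seq I) (F : I -> V) :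
  (forall i, coeffs_ge0 (F i)) -> coeffs_ge0 (\sum_(i <- D) F i).
Proof. by move=> F0 t; rewrite raddf_sum sumr_ge0//= => i _; exact: F0. Qed.

Lemma coeffs_ge0_linear (f : {linear V -> V}) v :
  (forall s, coeffs_ge0 (f (ket s))) -> coeffs_ge0 v -> coeffs_ge0 (f v).
Proof.
move=> f0 v0; rewrite (freeg_ketE v) linear_sum; apply: coeffs_ge0_sum => z t.
by rewrite linearZ coeffZ; apply: mulr_ge0; [exact: v0 | exact: f0].
Qed.

Lemma coeffs_ge0_ket s : coeffs_ge0 (ket s).
Proof. by move=> t; rewrite coeff_ket ler0n. Qed.

Lemma fsum_ket (A : set P) (f : P -> fi_split P) : finite_set A ->
  \sum_(x \in A) ket (f x) = \sum_(x <- fset_set A) ket (f x).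
Proof. by move=> fin; rewrite fsbig_finite. Qed.

Lemma fsum_ket_ge0 (A : set P) (f : P -> fi_split P) : finite_set A ->
  coeffs_ge0 (\sum_(x \in A) ket (f x)).
Proof.
by move=> fin; rewrite fsum_ket//; apply: coeffs_ge0_sum => x; exact: coeffs_ge0_ket.
Qed.

Lemma X_ket a s : X a (ket s) = \sum_(x \in minimals kappa a s) ket (filter_to_ideal s x).
Proof. exact: lin_ext_basis. Qed.

Lemma Y_ket a s : Y a (ket s) = \sum_(y \in maximals kappa a s) ket (ideal_to_filter s y).
Proof. exact: lin_ext_basis. Qed.

Lemma minimals_step a s : minimals kappa a s !=set0 <-> exists t, step a s t.
Proof.
split=> [[x [minx <-]]|[t [x xa mx]]]; first by eexists; exact: minimal_step.
by exists x; split=> //; exact: move_minimal mx.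
Qed.

Lemma maximals_step a s : maximals kappa a s !=set0 <-> exists r, step a r s.
Proof.
split=> [[x [minx <-]]|[t [x xa mx]]]; first by eexists; exact: maximal_step.
by exists x; split=> //; exact: move_maximal mx.
Qed.

Lemma X_ket_eq0 a s : ~ (exists t, step a s t) -> X a (ket s) = 0.
Proof.
move=> nost; rewrite X_ket; suff -> : minimals kappa a s = set0 by rewrite fsbig_set0.
by apply: contrapT => /eqP/set0P/minimals_step.
Qed.

Lemma Y_ket_eq0 a s : ~ (exists r, step a r s) -> Y a (ket s) = 0.
Proof.
move=> nost; rewrite Y_ket; suff -> : maximals kappa a s = set0 by rewrite fsbig_set0.
by apply: contrapT => /eqP/set0P/maximals_step.
Qed.

(** * From representations to coloring properties *)

Section FromRepresentation.
Hypothesis X_fin : X_finite kappa.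

Lemma X_ket_ge0 a s : coeffs_ge0 (X a (ket s)).
Proof. by rewrite X_ket; exact: fsum_ket_ge0 (X_fin a s). Qed.

Lemma X_ket_step a s t : step a s t ->
  exists2 v, coeffs_ge0 v & X a (ket s) = ket t + v.
Proof.
move=> [x xa mx]; rewrite X_ket fsum_ket//.
have xA : x \in fset_set (minimals kappa a s).
  by rewrite in_fset_set//; apply/mem_set; split=> //; exact: move_minimal mx.
rewrite (bigD1_seq x xA (fset_uniq _))/= (move_inj_r mx (minimal_move (move_minimal mx))).
eexists; last reflexivity.
by rewrite -big_filter; apply: coeffs_ge0_sum => y; exact: coeffs_ge0_ket.
Qed.

(** Every path of steps contributes a positive coefficient, so a vanishing
word in the operators excludes all its paths. *)
Lemma XX_ket_step a b s t u : step a s t -> step b t u ->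
  0 < coeff u (X b (X a (ket s))).
Proof.
move=> /X_ket_step[v v0 ->] /X_ket_step[w w0 E]; rewrite linearD E !coeffD coeff_ket eqxx.
rewrite -addrA ltr_pwDl ?ltr01// addr_ge0 ?w0//.
by apply: coeffs_ge0_linear => // r; exact: X_ket_ge0.
Qed.

Lemma square_nilpotent_no_repeated : X_square_nilpotent R kappa -> no_repeated_step kappa.
Proof.
by move=> X2 a s t u st tu; have := XX_ket_step st tu; rewrite X2 coeff0 ltxx.
Qed.

Lemma commuting_steps_swap :
  (forall a b, distant adj a b -> commutator (X b) (X a) = 0) ->
  distant_steps_swap adj kappa.
Proof.
move=> XX a b s t u dist st tu; apply: contrapT => nost.
have := congr1 (fun f => f (ket s)) (XX a b dist); rewrite commutatorE.
rewrite (X_ket_eq0 nost) linear0 subr0 => E.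
by have := XX_ket_step st tu; rewrite E coeff0 ltxx.
Qed.

Section DiagonalOperators.
Variables (H : G -> {linear V -> V}) (h : G -> fi_split P -> int).
Hypothesis Hh : forall a s, H a (ket s) = (h a s)%:~R *: ket s.

Lemma coeff_diagonal a t v : coeff t (H a v) = (h a t)%:~R * coeff t v.
Proof.
rewrite (freeg_ketE v) linear_sum !raddf_sum mulr_sumr; apply: eq_bigr => z _.
rewrite /= linearZZ Hh !coeffZ coeff_ket; case: eqP => [->|_]; last by rewrite !mulr0.
by rewrite !mulr1 mulrC.
Qed.

(** Comparing the coefficients of [t] in the relation applied to [s]: the
coefficient of [t] in [X_a s] is positive and can be cancelled. *)
Lemma HX_weight_shift : HX adj brk H X -> weight_shift adj kappa h.
Proof.
move=> hx a b s t st; have := congr1 (fun f => coeff t (f (ket s))) (hx a b).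
rewrite commutatorE -[((_ *: _) : V -> V) _]/((theta adj a b)%:~R *: X a (ket s)).
rewrite coeffB coeff_diagonal Hh linearZZ !coeffZ -mulrBl.
have [v v0 ->] := X_ket_step st.
have nz : coeff t (ket t + v) != 0.
  by rewrite gt_eqF// coeffD coeff_ket eqxx ltr_pwDl ?ltr01.
by move/(mulIf nz)/eqP; rewrite -rmorphB/= eqr_int subr_eq addrC => /eqP.
Qed.

End DiagonalOperators.

End FromRepresentation.

Lemma upper_minuscule_d_complete (H : G -> {linear V -> V}) : locally_finite P ->
  upper_P_minuscule adj kappa H -> colored_d_complete adj kappa.
Proof.
move=> P_lf [[Xfin diagH [[XX _] _ hx]] X2 eigH minH].
have /(_ _ _)/cid : forall a s, exists n : int, H a (ket s) = n%:~R *: ket s /\ -1 <= n.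
  move=> a s; have [c Hc] := diagH a s.
  have [cE|[n cE]] := eigH c (ex_intro _ a (ex_intro _ s Hc)).
    by exists (-1); rewrite Hc cE.
  by exists n%:Z; rewrite Hc cE; split=> //; lia.
move=> hP; pose h a s := projT1 (hP a s).
have Hh a s : H a (ket s) = (h a s)%:~R *: ket s := (projT2 (hP a s)).1.
have hge a s : -1 <= h a s := (projT2 (hP a s)).2.
have shift := HX_weight_shift Xfin Hh hx.
have norep := square_nilpotent_no_repeated Xfin X2.
have minw : minimal_weight kappa h.
  move=> a s; rewrite -minimals_step -minH Hh -scaleN1r.
  split=> [->|/scale_ket_inj/eqP]; first by rewrite rmorphN1.
  by rewrite -[-1]/((-1)%:~R) eqr_int => /eqP.
have swap := commuting_steps_swap Xfin XX.
exact: (weights_d_complete adj_sym adj_irr P_lf shift).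
Qed.

(** The weights lie in [{-1, 0, 1}] and a step adds [2] to the weight of
its own color, so a step out of [s] forces [-1], a step into [s] forces [1], and
two consecutive steps of one color are impossible. *)
Lemma minuscule_colored_minuscule (H : G -> {linear V -> V}) : locally_finite P ->
  P_minuscule adj kappa H -> colored_minuscule adj kappa.
Proof.
move=> P_lf [[Xfin Yfin diagH [[XX _] _ _ hx [_ [XY _]]]] eigH].
have /(_ _ _)/cid : forall a s, exists n : int,
    H a (ket s) = n%:~R *: ket s /\ (-1 <= n <= 1).
  move=> a s; have [c Hc] := diagH a s.
  have [cE|cE|cE] := eigH c (ex_intro _ a (ex_intro _ s Hc)).
  - by exists (-1); rewrite Hc cE.
  - by exists 0; rewrite Hc cE.
  - by exists 1; rewrite Hc cE.
move=> hP; pose h a s := projT1 (hP a s).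
have Hh a s : H a (ket s) = (h a s)%:~R *: ket s := (projT2 (hP a s)).1.
have hbd a s : -1 <= h a s <= 1 := (projT2 (hP a s)).2.
have hge a s : -1 <= h a s by case/andP: (hbd a s).
have hle a s : h a s <= 1 by case/andP: (hbd a s).
have shift := HX_weight_shift Xfin Hh hx.
have shift2 a s t : step a s t -> h a t = h a s + 2.
  by move=> /(shift a a); rewrite /theta eqxx.
have norep : no_repeated_step kappa.
  by move=> a s t u /shift2 E1 /shift2 E2; have := hle a u; have := hge a s; lia.
have XYE a s : X a (Y a (ket s)) - Y a (X a (ket s)) = (h a s)%:~R *: ket s.
  by rewrite -Hh -XY commutatorE.
have Xge0 a s := @X_ket_ge0 Xfin a s.
have Yge0 a s : coeffs_ge0 (Y a (ket s)) by rewrite Y_ket; exact: fsum_ket_ge0 (Yfin a s).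
have minw : minimal_weight kappa h.
  move=> a s; split=> [hE|[t /shift2 E]]; last first.
    by have := hle a t; have := hge a s; lia.
  apply: contrapT => nost; have := congr1 (coeff s) (XYE a s).
  rewrite (X_ket_eq0 nost) linear0 subr0 hE coeffZ coeff_ket eqxx mulr1 => E.
  have := coeffs_ge0_linear (Xge0 a) (Yge0 a s) s.
  by rewrite E rmorphN1 oppr_ge0 ler10.
have maxw : maximal_weight kappa h.
  move=> a s; split=> [hE|[t /shift2 E]]; last first.
    by have := hge a t; have := hle a s; lia.
  apply: contrapT => nost; have := congr1 (coeff s) (XYE a s).
  rewrite (Y_ket_eq0 nost) linear0 sub0r hE coeffN coeffZ coeff_ket eqxx mulr1 => E.
  have := coeffs_ge0_linear (Yge0 a) (Xge0 a s) s.
  by rewrite -[coeff _ _]opprK E rmorph1 oppr_ge0 ler10.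
have swap := commuting_steps_swap Xfin XX.
split; last exact: (weights_Mn1LA adj_sym adj_irr P_lf shift).
exact: (weights_d_complete adj_sym adj_irr P_lf shift).
Qed.

(** * From coloring properties to representations *)

Section ToRepresentation.

(** Under EC the operators and their words send a basis vector to a basis
vector or to zero; the relation [r] records which, and words in operators become
composites of relations. *)
Definition acts_by (f : V -> V) (r : fi_split P -> fi_split P -> Prop) :=
  (forall s t, r s t -> f (ket s) = ket t) /\
  (forall s, ~ (exists t, r s t) -> f (ket s) = 0).

Definition rel_comp (r q : fi_split P -> fi_split P -> Prop) s u :=
  exists2 t, r s t & q t u.

Lemma acts_by_comp (f : V -> V) (g : {linear V -> V}) r q :
  acts_by f r -> acts_by g q -> acts_by (g \o f) (rel_comp r q).
Proof.
move=> [fr f0] [gq g0]; split=> [s u [t st tu]|s nsu] /=.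
  by rewrite (fr _ _ st) (gq _ _ tu).
have [[t st]|nst] := EM (exists t, r s t); last by rewrite f0// linear0.
rewrite (fr _ _ st) g0// => -[u tu]; apply: nsu; exists u; by exists t.
Qed.

Lemma acts_by_eq (f g : V -> V) r q : acts_by f r -> acts_by g q ->
  (forall s t, r s t <-> q s t) -> forall s, f (ket s) = g (ket s).
Proof.
move=> [fr f0] [gq g0] rq s.
have [[t st]|nst] := EM (exists t, r s t).
  by rewrite (fr _ _ st) (gq s t)//; apply/rq.
by rewrite f0// g0// => -[t /rq st]; apply: nst; exists t.
Qed.

Lemma acts_by_eq0 (f : V -> V) r : acts_by f r -> (forall s t, ~ r s t) ->
  forall s, f (ket s) = 0.
Proof. by move=> [_ f0] nr s; apply: f0 => -[t]; exact: nr. Qed.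

(** For adjacent colors, [X_a^2 = 0] reduces the double bracket of [X_a]
with [X_b] to [-2 X_a X_b X_a]. *)
Lemma serre_relations_ket (Z : G -> {linear V -> V}) :
  (forall a b, distant adj a b -> forall s, Z b (Z a (ket s)) = Z a (Z b (ket s))) ->
  (forall a s, Z a (Z a (ket s)) = 0) ->
  (forall a b, adj a b -> forall s, Z a (Z b (Z a (ket s))) = 0) ->
  serre_relations adj brk Z.
Proof.
move=> ZZ Z2 ZZZ.
have dist a b : distant adj a b -> brk (Z b) (Z a) = 0.
  move=> ab; apply: linear_ket_eq0.
    by apply: commutator_linear; exact: linearP.
  by move=> s; rewrite commutatorE ZZ// subrr.
split=> // a b.
have brk0 (f : {linear V -> V}) : brk f 0 = 0.
  by apply/funext => v; rewrite commutatorE linear0 subr0.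
have [<-|ab] := eqVneq a b.
  by rewrite (_ : brk (Z a) (Z a) = 0) ?brk0//; apply/funext => v; rewrite commutatorE subrr.
have [adjab|nadj] := boolP (adj a b); last first.
  by rewrite (dist b a) ?brk0// /distant eq_sym ab adj_sym.
apply: linear_ket_eq0.
  by apply: commutator_linear; [|apply: commutator_linear]; exact: linearP.
have Z20 v : Z a (Z a v) = 0.
  have /(congr1 (fun f => f v)) // : Z a \o Z a = 0.
  by apply: linear_ket_eq0; [exact: linearP | exact: Z2].
move=> s; rewrite !commutatorE linearB/= !Z20 ZZZ// !linear0.
by rewrite !(subr0, addr0).
Qed.

Hypothesis dc : colored_d_complete adj kappa.

Let ec : EC kappa. Proof. by case: dc. Qed.
Let na : NA adj kappa. Proof. by case: dc. Qed.
Let i2a : I2A adj kappa. Proof. by case: dc. Qed.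

Let norep : no_repeated_step kappa. Proof. exact: (complete_no_repeated_step adj_irr). Qed.

Lemma minimals_set1 a s x : minimals kappa a s x -> minimals kappa a s = [set x].
Proof.
move=> [minx xa]; apply/seteqP; split=> [y [miny ya]|y ->//] /=.
by apply: comparable_minimal_eq miny minx; apply: ec; rewrite xa.
Qed.

Lemma maximals_set1 a s x : maximals kappa a s x -> maximals kappa a s = [set x].
Proof.
move=> [maxx xa]; apply/seteqP; split=> [y [maxy ya]|y ->//] /=.
by apply: comparable_maximal_eq maxy maxx; apply: ec; rewrite xa.
Qed.

Lemma X_acts a : acts_by (X a) (step a).
Proof.
split=> [s t [x xa mx]|s]; last exact: X_ket_eq0.
have minx := move_minimal mx.
rewrite X_ket (minimals_set1 (conj minx xa)) fsbig_set1.
by rewrite (move_inj_r mx (minimal_move minx)).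
Qed.

Lemma Y_acts a : acts_by (Y a) (fun s r => step a r s).
Proof.
split=> [s t [x xa mx]|s]; last exact: Y_ket_eq0.
have maxx := move_maximal mx.
rewrite Y_ket (maximals_set1 (conj maxx xa)) fsbig_set1.
by rewrite (move_inj_l mx (maximal_move maxx)).
Qed.

Lemma X_finite_complete : X_finite kappa.
Proof.
move=> a s; have [->|/set0P[x]] := eqVneq (minimals kappa a s) set0; first exact: finite_set0.
by move/minimals_set1 => ->.
Qed.

Lemma Y_finite_complete : Y_finite kappa.
Proof.
move=> a s; have [->|/set0P[x]] := eqVneq (maximals kappa a s) set0; first exact: finite_set0.
by move/maximals_set1 => ->.
Qed.

Lemma distantC a b : distant adj a b = distant adj b a.
Proof. by rewrite /distant eq_sym adj_sym. Qed.

Lemma X_serre : serre_relations adj brk X.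
Proof.
apply: serre_relations_ket => [a b ab|a|a b ab].
- apply: (acts_by_eq (acts_by_comp (X_acts a) (X_acts b))
                     (acts_by_comp (X_acts b) (X_acts a))).
  move=> s u; split=> [[t st tu]|[t st tu]].
    exact: (complete_swap ec na ab st tu).
  by apply: (complete_swap ec na _ st tu); rewrite distantC.
- apply: (acts_by_eq0 (acts_by_comp (X_acts a) (X_acts a))) => s u [t]; exact: norep.
- apply: (acts_by_eq0 (acts_by_comp (acts_by_comp (X_acts a) (X_acts b)) (X_acts a))).
  move=> s w [u [t st tu] uw].
  exact: (complete_no_sandwich adj_irr ec i2a ab st tu uw).
Qed.

(** The operators [Y_a] follow the steps backwards, so their relations are
those of the operators [X_a] read in the opposite direction. *)
Lemma Y_serre : serre_relations adj brk Y.
Proof.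
apply: serre_relations_ket => [a b ab|a|a b ab].
- apply: (acts_by_eq (acts_by_comp (Y_acts a) (Y_acts b))
                     (acts_by_comp (Y_acts b) (Y_acts a))).
  move=> s u; split=> [[t st tu]|[t st tu]].
    have [|t' h1 h2] := complete_swap ec na _ tu st; first by rewrite distantC.
    by exists t'.
  by have [t' h1 h2] := complete_swap ec na ab tu st; exists t'.
- apply: (acts_by_eq0 (acts_by_comp (Y_acts a) (Y_acts a))) => s u [t st tu].
  exact: norep tu st.
- apply: (acts_by_eq0 (acts_by_comp (acts_by_comp (Y_acts a) (Y_acts b)) (Y_acts a))).
  move=> s w [u [t st tu] uw].
  exact: (complete_no_sandwich adj_irr ec i2a ab uw tu st).
Qed.

Section Diagonal.
Variable h : G -> fi_split P -> int.
Hypothesis h_shift : weight_shift adj kappa h.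

Definition weight_op a : {linear V -> V} := lin_ext (fun s => (h a s)%:~R *: ket s).

Lemma weight_op_ket a s : weight_op a (ket s) = (h a s)%:~R *: ket s.
Proof. exact: lin_ext_basis. Qed.

Lemma weight_op_diagonal : Defs.diagonal weight_op.
Proof. by move=> a s; exists (h a s)%:~R; exact: weight_op_ket. Qed.

Lemma weight_op_eigenvalue c : eigenvalue_set weight_op c -> exists a s, c = (h a s)%:~R.
Proof. by move=> [a [s]]; rewrite weight_op_ket => /scale_ket_inj <-; exists a, s. Qed.

Lemma weight_op_HH : HH brk weight_op.
Proof.
move=> a b; apply: linear_ket_eq0.
  by apply: commutator_linear; exact: linearP.
move=> s; have WW c e : weight_op c (weight_op e (ket s)) =
    ((h e s)%:~R * (h c s)%:~R) *: ket s.
  by rewrite weight_op_ket linearZZ weight_op_ket scalerA.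
by rewrite commutatorE !WW mulrC subrr.
Qed.

Lemma weight_op_bracket (Z : {linear V -> V}) r b (c : int) : acts_by Z r ->
  (forall s t, r s t -> h b t = h b s + c) -> brk (weight_op b) Z = c%:~R *: (Z : V -> V).
Proof.
move=> [Zr Z0] hr; apply: linear_ket_eq.
- by apply: commutator_linear; exact: linearP.
- move=> k u v; rewrite -![(_ *: _) (_ + _)]/(c%:~R *: Z (_ + _)).
  rewrite -![((_ *: _) : V -> V) _]/(c%:~R *: Z _) linearP scalerDr !scalerA.
  by rewrite mulrC.
move=> s; rewrite commutatorE -[((_ *: _) : V -> V) _]/(c%:~R *: Z (ket s)).
rewrite weight_op_ket linearZZ; have [[t st]|nst] := EM (exists t, r s t).
  by rewrite (Zr _ _ st) weight_op_ket -scalerBl (hr _ _ st) -rmorphB/= addrC addKr.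
by rewrite Z0// linear0 !scaler0 subrr.
Qed.

Lemma weight_op_HX : HX adj brk weight_op X.
Proof. by move=> a b; apply: (weight_op_bracket (X_acts a)) => s t; exact: h_shift. Qed.

Lemma weight_op_HY : HY adj brk weight_op Y.
Proof.
move=> a b; rewrite -rmorphN; apply: (weight_op_bracket (Y_acts a)) => s t /(h_shift b) ->.
by rewrite addrK.
Qed.

Lemma weight_op_borel : borel_representation adj kappa weight_op.
Proof.
split; [exact: X_finite_complete|exact: weight_op_diagonal|].
by split; [exact: X_serre | exact: weight_op_HH | exact: weight_op_HX].
Qed.

Hypothesis h_ge : forall a s, -1 <= h a s.
Hypothesis h_min : minimal_weight kappa h.

Lemma weight_op_upper_minuscule : upper_P_minuscule adj kappa weight_op.
Proof.
split; first exact: weight_op_borel.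
- move=> a v; suff /(congr1 (fun f => f v)) : X a \o X a = 0 by [].
  apply: linear_ket_eq0; first exact: linearP.
  by apply: (acts_by_eq0 (acts_by_comp (X_acts a) (X_acts a))) => s u [t]; exact: norep.
- move=> c /weight_op_eigenvalue[a [s ->]] /=.
  have := h_ge a s; case: (h a s) => [n _|[|n]]//; last by left.
  by right; exists n.
- move=> s a; rewrite minimals_step -h_min weight_op_ket -scaleN1r.
  split=> [/scale_ket_inj/eqP|->]; last by rewrite rmorphN1.
  by rewrite -[-1]/((-1)%:~R) eqr_int => /eqP.
Qed.

Hypothesis h_le : forall a s, h a s <= 1.
Hypothesis h_max : maximal_weight kappa h.

(** For equal colors, at most one of the two products is nonzero on [s],
according to whether a step enters or leaves [s], that is, whether the weight is
[1] or [-1]. For distinct colors the two products agree by the diamond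
properties of moves. *)
Lemma weight_op_XY : XY brk X Y weight_op.
Proof.
split=> [a|a b ab].
  apply: linear_ket_eq.
  - by apply: commutator_linear; exact: linearP.
  - exact: linearP.
  move=> s; rewrite commutatorE weight_op_ket.
  have [[r rs]|nrs] := EM (exists r, step a r s).
    have nst : ~ (exists t, step a s t) by move=> [t]; exact: norep rs.
    have -> : h a s = 1 by apply/h_max; exists r.
    rewrite ((Y_acts a).1 _ _ rs) ((X_acts a).1 _ _ rs) (X_ket_eq0 nst).
    by rewrite linear0 subr0 scale1r.
  rewrite (Y_ket_eq0 nrs) linear0 sub0r.
  have [[t st]|nst] := EM (exists t, step a s t).
    have -> : h a s = -1 by apply/h_min; exists t.
    by rewrite ((X_acts a).1 _ _ st) ((Y_acts a).1 _ _ st) rmorphN1 scaleN1r.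
  rewrite (X_ket_eq0 nst) linear0 oppr0.
  have h1 : h a s <> 1 by move/h_max.
  have hN1 : h a s <> -1 by move/h_min.
  have -> : h a s = 0 by have := h_le a s; have := h_ge a s; lia.
  by rewrite scale0r.
apply: linear_ket_eq0.
  by apply: commutator_linear; exact: linearP.
move=> s; rewrite commutatorE; apply/eqP; rewrite subr_eq0; apply/eqP; move: s.
apply: (acts_by_eq (acts_by_comp (Y_acts a) (X_acts b)) (acts_by_comp (X_acts b) (Y_acts a))).
move=> s t; split=> [[r rs rt]|[u su tu]].
  by have [u su tu] := step_diamond_down ab rs rt; exists u.
by have [r h1 h2] := step_diamond_up ab tu su; exists r.
Qed.

Lemma weight_op_minuscule : P_minuscule adj kappa weight_op.
Proof.
split=> [|c /weight_op_eigenvalue[a [s ->]] /=].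
  split; [exact: X_finite_complete|exact: Y_finite_complete|exact: weight_op_diagonal|].
  split; [exact: X_serre|exact: Y_serre|exact: weight_op_HH|exact: weight_op_HX|].
  by split; [exact: weight_op_HY | exact: weight_op_XY].
have := h_le a s; have := h_ge a s.
case: (h a s) => [[|[|n]]|[|n]]// _ _; [exact: Or32 | exact: Or33 | exact: Or31].
Qed.

End Diagonal.

End ToRepresentation.

End Operators.

Theorem theorem12p1 (R : realType)
    (G : finType) (adj : rel G)
    (adj_sym : symmetric adj) (adj_irr : irreflexive adj)
    (d : Order.disp_t) (P : porderType d) (P_lf : locally_finite P)
    (kappa : P -> G) (kappa_surj : forall a : G, exists x : P, kappa x = a) :
  (carries_upper_P_minuscule R adj kappa <-> colored_d_complete adj kappa) /\
  (carries_P_minuscule R adj kappa <-> colored_minuscule adj kappa).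
Proof.
split; split.
- by move=> [H]; exact: upper_minuscule_d_complete.
- move=> dc; have [ec na ac i2a mx1ga] := dc.
  exists (weight_op R (weight adj kappa)).
  by apply: weight_op_upper_minuscule => //;
    [exact: weight_shiftP | exact: weight_ge_opp1 | exact: weight_minimalP].
- by move=> [H]; exact: minuscule_colored_minuscule.
- move=> [dc mn1la]; have [ec na ac i2a mx1ga] := dc.
  exists (weight_op R (weight adj kappa)).
  by apply: weight_op_minuscule => //;
    [exact: weight_shiftP | exact: weight_ge_opp1 | exact: weight_minimalP
    |exact: weight_le1 | exact: weight_maximalP].
Qed.
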